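(* Let $F,G,H\colon\mathcal T\to\mathcal T'$ be exact functors between triangulated categories and $\sharp\in\{b,d,v\}$, or exact functors between strongly triangulated categories and $\sharp=s$. Suppose there is a natural $\sharp$-triangle $$F(X)\xrightarrow{f(X)}G(X)\xrightarrow{i(X)}H(X)\xrightarrow{q(X)}\Sigma F(X)$$ such that for any $\sharp$-triangle $X\xrightarrow{f}Y\xrightarrow{i}Z\xrightarrow{q}\Sigma X$ in $\mathcal T$ the $3\times3$ diagram with rows the $\sharp$-triangles $F(X)\xrightarrow{f(X)}G(X)\xrightarrow{i(X)}H(X)\xrightarrow{q(X)}\Sigma F(X)$, $F(Y)\xrightarrow{f(Y)}G(Y)\xrightarrow{i(Y)}H(Y)\xrightarrow{q(Y)}\Sigma F(Y)$, $F(Z)\xrightarrow{f(Z)}G(Z)\xrightarrow{i(Z)}H(Z)\xrightarrow{q(Z)}\Sigma F(Z)$ and columns the images of $X\xrightarrow fY\xrightarrow iZ\xrightarrow q\Sigma X$ under $F$, $G$, $H$ is $\sharp$-coherent. Then $$K_i({}^\sharp F)+K_i({}^\sharp H)=K_i({}^\sharp G)\colon K_i({}^\sharp\mathcal T)\longrightarrow K_i({}^\sharp\mathcal T'),\qquad i=0,1.$$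
   Context: Stable quadratic modules. Groups are additive, $[x,y]=-x-y+x+y$. A stable quadratic module $C_*$ consists of homomorphisms $C_0^{ab}\otimes C_0^{ab}\xrightarrow{\langle\cdot,\cdot\rangle}C_1\xrightarrow{\partial}C_0$ with $\langle c_0,c_0'\rangle+\langle c_0',c_0\rangle=0$, $\partial\langle c_0,c_0'\rangle=[c_0',c_0]$, $\langle\partial c_1,\partial c_1'\rangle=[c_1',c_1]$; $C_0$ acts on $C_1$ by $c_1^{c_0}=c_1+\langle c_0,\partial c_1\rangle$; $\pi_0C_*=C_0/\partial C_1$, $\pi_1C_*=\ker\partial$. Presentations by generators in degrees $0,1$ and relations have the evident universal property. Triangles. $\mathcal T$ has suspension $\Sigma$ and chosen zero object $0$. A triangle is $X\xrightarrow fY\xrightarrow iC\xrightarrow q\Sigma X$ with consecutive composites (also $(\Sigma f)q$) zero. An octahedral diagram on $X\xrightarrow fY\xrightarrow gZ$ consists of triangles $\Delta_f\colon X\xrightarrow{f}Y\xrightarrow{i^f}C^f\xrightarrow{q^f}\Sigma X$, $\Delta_g\colon Y\xrightarrow{g}Z\xrightarrow{i^g}C^g\xrightarrow{q^g}\Sigma Y$, $\Delta_{gf}\colon X\xrightarrow{gf}Z\xrightarrow{i^{gf}}C^{gf}\xrightarrow{q^{gf}}\Sigma X$, $\widetilde\Delta\colon C^f\xrightarrow{\bar g}C^{gf}\xrightarrow{\bar f}C^g\xrightarrow{(\Sigma i^f)q^g}\Sigma C^f$ with $\bar g i^f=i^{gf}g$, $q^{gf}\bar g=q^f$, $\bar f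 i^{gf}=i^g$, $q^g\bar f=(\Sigma f)q^{gf}$. It is an (ordinary) octahedron if all four triangles are distinguished; special if moreover $Y\xrightarrow{(g,-i^f)}Z\oplus C^f\xrightarrow{(i^{gf},\bar g)}C^{gf}\xrightarrow{q^g\bar f}\Sigma Y$ and $C^{gf}\xrightarrow{(q^{gf},-\bar f)}\Sigma X\oplus C^g\xrightarrow{(\Sigma f,q^g)}\Sigma Y\xrightarrow{\Sigma(\bar g i^f)}\Sigma C^{gf}$ are distinguished. Contractible triangles are direct sums of triangles $A\xrightarrow1A\to0\to\Sigma A$, $0\to B\xrightarrow1B\to0$, $C\to0\to\Sigma C\xrightarrow1\Sigma C$. A triangle is virtual if its sum with some contractible triangle is isomorphic to some $(f',i',q')$ such that there are distinguished triangles $(f'',i',q')$, $(f',i'',q')$, $(f',i',q'')$ on the same objects. A virtual octahedron is an octahedral diagram whose four triangles are virtual. A strongly triangulated category (Maltsiniotis) is a triangulated category with distinguished $n$-triangles for all $n$ satisfying axioms generalizing those for distinguished triangles; only its distinguished octahedra ($3$-triangles) matter here; exact functors between such preserve the distinguished $n$-triangles. Exact functors come with natural isomorphisms $F\Sigma\cong\Sigma F$, used implicitly. A $\sharp$-triangle is a distinguished triangle if $\sharp=b,d,s$ and a virtual triangle if $\sharp=v$; a $\sharp$-octahedron is an ordinary, special, virtual, distinguished octahedron for $\sharp=b,d,v,s$ respectively. $3\times3$ diagrams. A $3\times3$ diagram consists of $\sharp$-triangles (rows) $(f^X,i^X,q^X)$, $(f^Y,i^Y,q^Y)$, $(f^Z,i^Z,q^Z)$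 on objects $X',X,X''$; $Y',Y,Y''$; $Z',Z,Z''$, and (columns) $(f',i',q')$, $(f,i,q)$, $(f'',i'',q'')$ on $X',Y',Z'$; $X,Y,Z$; $X'',Y'',Z''$, such that $ff^X=f^Yf'$, $f''i^X=i^Yf$, $(\Sigma f')q^X=q^Yf''$, $if^Y=f^Zi'$, $i''i^Y=i^Zi$, $(\Sigma i')q^Y=q^Zi''$, $qf^Z=(\Sigma f^X)q'$, $q''i^Z=(\Sigma i^X)q$ and $(\Sigma q')q^Z+(\Sigma q^X)q''=0$. It is $\sharp$-coherent if there are an object $W$ and morphisms $\bar f'\colon X\to W$, $\bar f^X\colon Y'\to W$, $\delta\colon X'\to W$, $\bar i^X\colon W\to X''$, $\bar i'\colon W\to Z'$, $\varepsilon\colon W\to Y$, $\kappa\colon Z''\to\Sigma W$ such that the following are $\sharp$-octahedra (triangles listed in the order $\Delta_f,\Delta_g,\Delta_{gf},\widetilde\Delta$): (O1) on $X'\xrightarrow{f^X}X\xrightarrow{\bar f'}W$, composite $\delta$: $(f^X,i^X,q^X)$; $X\xrightarrow{\bar f'}W\xrightarrow{\bar i'}Z'\xrightarrow{(\Sigma f^X)q'}\Sigma X$; $X'\xrightarrow{\delta}W\xrightarrow{(\bar i^X,\bar i')}X''\oplus Z'\xrightarrow{(q^X,q')}\Sigma X'$; $X''\to X''\oplus Z'\to Z'\xrightarrow0\Sigma X''$; (O2) on $X'\xrightarrow{f'}Y'\xrightarrow{\bar f^X}W$, composite $\delta$: $(f',i',q')$; $Y'\xrightarrow{\bar f^X}W\xrightarrow{\bar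 i^X}X''\xrightarrow{(\Sigma f')q^X}\Sigma Y'$; the triangle on $\delta$ of (O1); $Z'\to X''\oplus Z'\to X''\xrightarrow0\Sigma Z'$; (O3) on $X\xrightarrow{\bar f'}W\xrightarrow{\varepsilon}Y$, composite $f$: the second triangle of (O1); $W\xrightarrow{\varepsilon}Y\xrightarrow{i^Zi}Z''\xrightarrow{\kappa}\Sigma W$; $(f,i,q)$; $(f^Z,i^Z,q^Z)$; (O4) on $Y'\xrightarrow{\bar f^X}W\xrightarrow{\varepsilon}Y$, composite $f^Y$: the second triangle of (O2); $W\xrightarrow{\varepsilon}Y\xrightarrow{i''i^Y}Z''\xrightarrow{\kappa}\Sigma W$; $(f^Y,i^Y,q^Y)$; $(f'',i'',q'')$. $\mathcal D_*({}^\sharp\mathcal T)$ is presented by generators $[X]$ (degree $0$) for each object, $[h]$ (degree $1$) for each isomorphism $h\colon X\to X'$, $[\Delta]$ (degree $1$) for each $\sharp$-triangle $\Delta=(X\to Y\to C\to\Sigma X)$, and relations: $\partial[h]=-[X']+[X]$; $\partial[\Delta]=-[Y]+[C]+[X]$; $[0]=0$; $[1_X]=0$; $[X\xrightarrow1X\to0\to\Sigma X]=0=[0\to X\xrightarrow1X\to0]$; $[kh]=[k]+[h]$; $[a]+[c]^{[X]}=-[\Delta']+[b]+[\Delta]$ for each isomorphism $(a,b,c)\colon\Delta\to\Delta'$ of $\sharp$-triangles; $[\Delta_g]+[\Delta_f]=[\Delta_{gf}]+[\widetilde\Delta]^{[X]}$ for each $\sharp$-octahedron; $\langle[X],[Y]\rangle=-[\Delta_2]+[\Delta_1]$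 with $\Delta_1\colon X\to X\oplus Y\to Y\xrightarrow0\Sigma X$, $\Delta_2\colon Y\to X\oplus Y\to X\xrightarrow0\Sigma Y$. $K_i({}^\sharp\mathcal T)$ is identified with $\pi_i\mathcal D_*({}^\sharp\mathcal T)$, $i=0,1$, and $K_i({}^\sharp F)$ is the homomorphism induced by $F$ on generators. *)

(* Defs.v *)
From HB Require Import structures.
From mathcomp Require Import all_boot all_order all_algebra.
From mathcomp Require Import boolp.
From Stdlib Require Import Setoid Morphisms.

Set Implicit Arguments.
Unset Strict Implicit.
Unset Printing Implicit Defensive.

Import Order.TTheory GRing.Theory Num.Theory.
Local Open Scope ring_scope.

(* Objects may form a type in a larger universe than the groups of morphisms;
   a zero object and biproducts are part of the structure. *)
Record addCat := AddCat {
  Ob :> Type;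
  Hom : Ob -> Ob -> zmodType;
  idm : forall X, Hom X X;
  comp : forall X Y Z, Hom Y Z -> Hom X Y -> Hom X Z;
  compA : forall X Y Z W (h : Hom Z W) (g : Hom Y Z) (f : Hom X Y),
    comp h (comp g f) = comp (comp h g) f;
  comp1m : forall X Y (f : Hom X Y), comp (idm Y) f = f;
  compm1 : forall X Y (f : Hom X Y), comp f (idm X) = f;
  compDl : forall X Y Z (g g' : Hom Y Z) (f : Hom X Y),
    comp (g + g') f = comp g f + comp g' f;
  compDr : forall X Y Z (g : Hom Y Z) (f f' : Hom X Y),
    comp g (f + f') = comp g f + comp g f';
  zob : Ob;
  zobP : idm zob = 0;
  biprod : Ob -> Ob -> Ob;
  in1 : forall X Y, Hom X (biprod X Y);
  in2 : forall X Y, Hom Y (biprod X Y);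
  pr1 : forall X Y, Hom (biprod X Y) X;
  pr2 : forall X Y, Hom (biprod X Y) Y;
  pr1in1 : forall X Y, comp (pr1 X Y) (in1 X Y) = idm X;
  pr2in2 : forall X Y, comp (pr2 X Y) (in2 X Y) = idm Y;
  pr1in2 : forall X Y, comp (pr1 X Y) (in2 X Y) = 0;
  pr2in1 : forall X Y, comp (pr2 X Y) (in1 X Y) = 0;
  biprodP : forall X Y,
    comp (in1 X Y) (pr1 X Y) + comp (in2 X Y) (pr2 X Y) = idm (biprod X Y)
}.

Arguments idm {a} X.
Arguments comp {a X Y Z}.
Arguments zob {a}.
Arguments in1 {a} X Y.
Arguments in2 {a} X Y.
Arguments pr1 {a} X Y.
Arguments pr2 {a} X Y.

Notation "g \c f" := (comp g f) (at level 40, left associativity).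
Notation "X \o+ Y" := (biprod X Y) (at level 50, left associativity).

Section AddCatTheory.
Variable C : addCat.
Implicit Types X Y Z W : C.

Definition is_iso X Y (f : Hom X Y) : Prop :=
  exists g : Hom Y X, g \c f = idm X /\ f \c g = idm Y.

Definition pairm X Y Z (u : Hom X Y) (v : Hom X Z) : Hom X (Y \o+ Z) :=
  in1 Y Z \c u + in2 Y Z \c v.

Definition copairm X Y Z (u : Hom X Z) (v : Hom Y Z) : Hom (X \o+ Y) Z :=
  u \c pr1 X Y + v \c pr2 X Y.

Definition summ X Y X' Y' (u : Hom X Y) (v : Hom X' Y') :
  Hom (X \o+ X') (Y \o+ Y') := pairm (u \c pr1 X X') (v \c pr2 X X').

Lemma comp0m X Y Z (f : Hom X Y) : (0 : Hom Y Z) \c f = 0.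
Proof. by apply: (addrI (0 \c f)); rewrite -compDl !addr0. Qed.

Lemma compm0 X Y Z (g : Hom Y Z) : g \c (0 : Hom X Y) = 0.
Proof. by apply: (addrI (g \c 0)); rewrite -compDr !addr0. Qed.

Lemma compNm X Y Z (g : Hom Y Z) (f : Hom X Y) : (- g) \c f = - (g \c f).
Proof. by apply: (addrI (g \c f)); rewrite -compDl !addrN comp0m. Qed.

Lemma compmN X Y Z (g : Hom Y Z) (f : Hom X Y) : g \c (- f) = - (g \c f).
Proof. by apply: (addrI (g \c f)); rewrite -compDr !addrN compm0. Qed.

Lemma pr1_pair X Y Z (u : Hom X Y) (v : Hom X Z) : pr1 Y Z \c pairm u v = u.
Proof. by rewrite compDr !compA pr1in1 pr1in2 comp0m addr0 comp1m. Qed.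

Lemma pr2_pair X Y Z (u : Hom X Y) (v : Hom X Z) : pr2 Y Z \c pairm u v = v.
Proof. by rewrite compDr !compA pr2in2 pr2in1 comp0m add0r comp1m. Qed.

Lemma copair_in1 X Y Z (u : Hom X Z) (v : Hom Y Z) :
  copairm u v \c in1 X Y = u.
Proof. by rewrite compDl -!compA pr1in1 pr2in1 compm0 addr0 compm1. Qed.

Lemma copair_in2 X Y Z (u : Hom X Z) (v : Hom Y Z) :
  copairm u v \c in2 X Y = v.
Proof. by rewrite compDl -!compA pr1in2 pr2in2 compm0 add0r compm1. Qed.

Lemma pairE X Y Z (u v : Hom X (Y \o+ Z)) :
  pr1 Y Z \c u = pr1 Y Z \c v -> pr2 Y Z \c u = pr2 Y Z \c v -> u = v.
Proof.
move=> e1 e2; rewrite -(comp1m u) -(comp1m v) -biprodP !compDl -!compA.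
by rewrite e1 e2.
Qed.

Lemma copairE X Y Z (u v : Hom (X \o+ Y) Z) :
  u \c in1 X Y = v \c in1 X Y -> u \c in2 X Y = v \c in2 X Y -> u = v.
Proof.
move=> e1 e2; rewrite -(compm1 u) -(compm1 v) -biprodP !compDr !compA.
by rewrite e1 e2.
Qed.

Lemma to_zero X Y (f : Hom X Y) : idm Y = 0 -> f = 0.
Proof. by move=> e; rewrite -(comp1m f) e comp0m. Qed.

Lemma from_zero X Y (f : Hom X Y) : idm X = 0 -> f = 0.
Proof. by move=> e; rewrite -(compm1 f) e compm0. Qed.

Lemma iso_id X : is_iso (idm X).
Proof. by exists (idm X); rewrite comp1m. Qed.

Lemma iso_comp X Y Z (g : Hom Y Z) (f : Hom X Y) :
  is_iso g -> is_iso f -> is_iso (g \c f).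
Proof.
move=> [g' [g1 g2]] [f' [f1 f2]]; exists (f' \c g'); split.
  by rewrite compA -(compA f') g1 compm1.
by rewrite compA -(compA g) f2 compm1.
Qed.

End AddCatTheory.

Record addFun (C D : addCat) := AddFun {
  fob :> C -> D;
  fmap : forall X Y : C, Hom X Y -> Hom (fob X) (fob Y);
  fmap1 : forall X : C, fmap (idm X) = idm (fob X);
  fmapM : forall (X Y Z : C) (g : Hom Y Z) (f : Hom X Y),
    fmap (g \c f) = fmap g \c fmap f;
  fmapD : forall (X Y : C) (f g : Hom X Y), fmap (f + g) = fmap f + fmap g
}.

Arguments fmap {C D} a {X Y}.

Section AddFunTheory.
Variables (C D : addCat) (F : addFun C D).

Lemma fmap0 (X Y : C) : fmap F (0 : Hom X Y) = 0.
Proof. by apply: (addrI (fmap F 0)); rewrite -fmapD !addr0. Qed.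

Lemma fmapN (X Y : C) (f : Hom X Y) : fmap F (- f) = - fmap F f.
Proof. by apply: (addrI (fmap F f)); rewrite -fmapD !addrN fmap0. Qed.

Lemma fmap_iso (X Y : C) (f : Hom X Y) : is_iso f -> is_iso (fmap F f).
Proof. by move=> [g [e1 e2]]; exists (fmap F g); rewrite -!fmapM e1 e2 !fmap1. Qed.

Definition fsum (X Y : C) : Hom (F (X \o+ Y)) (F X \o+ F Y) :=
  pairm (fmap F (pr1 X Y)) (fmap F (pr2 X Y)).

Lemma fsum_iso (X Y : C) : is_iso (fsum X Y).
Proof.
exists (copairm (fmap F (in1 X Y)) (fmap F (in2 X Y))); split.
  rewrite /copairm compDl -!compA pr1_pair pr2_pair -!fmapM -fmapD biprodP.
  exact: fmap1.
apply: copairE; rewrite comp1m -compA ?copair_in1 ?copair_in2 /fsum /pairm.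
  by rewrite compDl -!compA -!fmapM pr1in1 pr2in1 fmap0 fmap1 compm0 addr0 compm1.
by rewrite compDl -!compA -!fmapM pr1in2 pr2in2 fmap0 fmap1 compm0 add0r compm1.
Qed.

End AddFunTheory.

(* The suspension is a self-equivalence, not necessarily invertible on the
   nose. *)
Record suspCat := SuspCat {
  susp_base :> addCat;
  susp : addFun susp_base susp_base;
  susp_faithful : forall (X Y : susp_base), injective (@fmap _ _ susp X Y);
  susp_full : forall (X Y : susp_base) (g : Hom (susp X) (susp Y)),
    exists f : Hom X Y, fmap susp f = g;
  susp_surj : forall Y : susp_base,
    exists (X : susp_base) (h : Hom (susp X) Y), is_iso h
}.

Arguments susp {s}.

Section Triangles.
Variable T : suspCat.
Implicit Types X Y Z C : T.

(* Composites are not assumed to vanish, see [is_triangle]. *)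
Record Tri := MkTri {
  tX : T; tY : T; tC : T;
  tf : Hom tX tY; ti : Hom tY tC; tq : Hom tC (susp tX)
}.

Definition is_triangle (D : Tri) : Prop :=
  [/\ ti D \c tf D = 0, tq D \c ti D = 0 & fmap susp (tf D) \c tq D = 0].

Definition is_tri_map (D D' : Tri) (a : Hom (tX D) (tX D'))
    (b : Hom (tY D) (tY D')) (c : Hom (tC D) (tC D')) : Prop :=
  [/\ b \c tf D = tf D' \c a, c \c ti D = ti D' \c b
    & fmap susp a \c tq D = tq D' \c c].

Definition is_tri_iso (D D' : Tri) (a : Hom (tX D) (tX D'))
    (b : Hom (tY D) (tY D')) (c : Hom (tC D) (tC D')) : Prop :=
  [/\ is_iso a, is_iso b, is_iso c & is_tri_map a b c].

Definition tri_iso (D D' : Tri) : Prop :=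
  exists a b c, @is_tri_iso D D' a b c.

Definition tri_sum (D D' : Tri) : Tri :=
  MkTri (summ (tf D) (tf D')) (summ (ti D) (ti D'))
    (copairm (fmap susp (in1 (tX D) (tX D')) \c tq D)
             (fmap susp (in2 (tX D) (tX D')) \c tq D')).

Definition tri_id1 X : Tri := MkTri (idm X) (0 : Hom X zob) 0.
Definition tri_id2 X : Tri := MkTri (0 : Hom zob X) (idm X) 0.
Definition tri_id3 X : Tri := MkTri (0 : Hom X zob) 0 (idm (susp X)).

(* Up to isomorphism, every direct sum of triangles of the three types above is
   of this form, and isomorphisms are allowed in [is_virtual]. *)
Definition tri_contr X Y Z : Tri :=
  tri_sum (tri_sum (tri_id1 X) (tri_id2 Y)) (tri_id3 Z).

Definition tri_split X Y : Tri := MkTri (in1 X Y) (pr2 X Y) 0.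
Definition tri_split' X Y : Tri := MkTri (in2 X Y) (pr1 X Y) 0.

(* The data of an octahedral diagram on X -f-> Y -g-> Z.  The composite [ogf]
   and the last morphism [oqt] of the fourth triangle are fields of their own;
   they are identified with g f and (Sigma i^f) q^g in [is_oct_diagram]. *)
Record Oct := MkOct {
  oX : T; oY : T; oZ : T; oCf : T; oCg : T; oCgf : T;
  of_ : Hom oX oY; oif : Hom oY oCf; oqf : Hom oCf (susp oX);
  og : Hom oY oZ; oig : Hom oZ oCg; oqg : Hom oCg (susp oY);
  ogf : Hom oX oZ; oigf : Hom oZ oCgf; oqgf : Hom oCgf (susp oX);
  ogb : Hom oCf oCgf; ofb : Hom oCgf oCg; oqt : Hom oCg (susp oCf)
}.

Definition oct_f (O : Oct) : Tri := MkTri (of_ O) (oif O) (oqf O).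
Definition oct_g (O : Oct) : Tri := MkTri (og O) (oig O) (oqg O).
Definition oct_gf (O : Oct) : Tri := MkTri (ogf O) (oigf O) (oqgf O).
Definition oct_t (O : Oct) : Tri := MkTri (ogb O) (ofb O) (oqt O).

Definition oct_all (P : Tri -> Prop) (O : Oct) : Prop :=
  [/\ P (oct_f O), P (oct_g O), P (oct_gf O) & P (oct_t O)].

Definition is_oct_diagram (O : Oct) : Prop :=
  oct_all is_triangle O /\
  [/\ ogf O = og O \c of_ O, oqt O = fmap susp (oif O) \c oqg O
    & [/\ ogb O \c oif O = oigf O \c og O, oqgf O \c ogb O = oqf O,
          ofb O \c oigf O = oig O
        & oqg O \c ofb O = fmap susp (of_ O) \c oqgf O]].

Definition oct_iso (O O' : Oct) : Prop :=
  exists (x : Hom (oX O) (oX O')) (y : Hom (oY O) (oY O'))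
    (z : Hom (oZ O) (oZ O')) (cf : Hom (oCf O) (oCf O'))
    (cg : Hom (oCg O) (oCg O')) (cgf : Hom (oCgf O) (oCgf O')),
  [/\ @is_tri_iso (oct_f O) (oct_f O') x y cf,
      @is_tri_iso (oct_g O) (oct_g O') y z cg,
      @is_tri_iso (oct_gf O) (oct_gf O') x z cgf
    & @is_tri_iso (oct_t O) (oct_t O') cf cgf cg].

(* These two triangles are required to be distinguished in a special
   octahedron. *)
Definition oct_mv1 (O : Oct) : Tri :=
  MkTri (pairm (og O) (- oif O)) (copairm (oigf O) (ogb O)) (oqg O \c ofb O).
Definition oct_mv2 (O : Oct) : Tri :=
  MkTri (pairm (oqgf O) (- ofb O)) (copairm (fmap susp (of_ O)) (oqg O))
    (fmap susp (ogb O \c oif O)).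

End Triangles.

Record triCat := TriCat {
  tri_base :> suspCat;
  dist : Tri tri_base -> Prop;
  dist_triangle : forall D, dist D -> is_triangle D;
  dist_iso : forall D D', tri_iso D D' -> dist D -> dist D';
  dist_id : forall X : tri_base, dist (tri_id1 X);
  dist_ext : forall (X Y : tri_base) (f : Hom X Y),
    exists (C : tri_base) (i : Hom Y C) (q : Hom C (susp X)), dist (MkTri f i q);
  dist_rot : forall D : Tri tri_base,
    dist D <-> dist (MkTri (ti D) (tq D) (- fmap susp (tf D)));
  dist_map : forall (D D' : Tri tri_base) (a : Hom (tX D) (tX D'))
      (b : Hom (tY D) (tY D')),
    dist D -> dist D' -> b \c tf D = tf D' \c a ->
    exists c : Hom (tC D) (tC D'), is_tri_map a b c;
  dist_oct : forall (X Y Z Cf Cg Cgf : tri_base)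
      (f : Hom X Y) (i : Hom Y Cf) (q : Hom Cf (susp X))
      (g : Hom Y Z) (ig : Hom Z Cg) (qg : Hom Cg (susp Y))
      (igf : Hom Z Cgf) (qgf : Hom Cgf (susp X)),
    dist (MkTri f i q) -> dist (MkTri g ig qg) -> dist (MkTri (g \c f) igf qgf) ->
    exists (gb : Hom Cf Cgf) (fb : Hom Cgf Cg),
      let O := MkOct f i q g ig qg (g \c f) igf qgf gb fb
                 (fmap susp i \c qg) in
      is_oct_diagram O /\ dist (oct_t O)
}.

(* The three distinguished triangles share the objects of the triangle
   (f', i', q') and differ from it in one morphism each. *)
Definition is_virtual (T : triCat) (D : Tri T) : Prop :=
  is_triangle D /\
  exists (A B C : T) (D' : Tri T),
    tri_iso (tri_sum D (tri_contr A B C)) D' /\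
    [/\ exists f'' : Hom (tX D') (tY D'), dist (MkTri f'' (ti D') (tq D')),
        exists i'' : Hom (tY D') (tC D'), dist (MkTri (tf D') i'' (tq D'))
      & exists q'' : Hom (tC D') (susp (tX D')),
          dist (MkTri (tf D') (ti D') q'')].

Record exactFun (T T' : triCat) := ExactFun {
  exact_fun :> addFun T T';
  fsusp : forall X : T, Hom (exact_fun (susp X)) (susp (exact_fun X));
  fsusp_iso : forall X : T, is_iso (fsusp X);
  fsusp_nat : forall (X Y : T) (h : Hom X Y),
    fsusp Y \c fmap exact_fun (fmap susp h)
    = fmap susp (fmap exact_fun h) \c fsusp X;
  exact_dist : forall D : Tri T, dist D ->
    dist (MkTri (fmap exact_fun (tf D)) (fmap exact_fun (ti D))
                (fsusp (tX D) \c fmap exact_fun (tq D)))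
}.

Arguments fsusp {T T'} e X.

Section Image.
Variables (T T' : triCat) (F : exactFun T T').

Definition ftri (D : Tri T) : Tri T' :=
  MkTri (fmap F (tf D)) (fmap F (ti D)) (fsusp F (tX D) \c fmap F (tq D)).

Definition foct (O : Oct T) : Oct T' :=
  MkOct (fmap F (of_ O)) (fmap F (oif O)) (fsusp F (oX O) \c fmap F (oqf O))
        (fmap F (og O)) (fmap F (oig O)) (fsusp F (oY O) \c fmap F (oqg O))
        (fmap F (ogf O)) (fmap F (oigf O)) (fsusp F (oX O) \c fmap F (oqgf O))
        (fmap F (ogb O)) (fmap F (ofb O)) (fsusp F (oCf O) \c fmap F (oqt O)).

End Image.

(* An n-triangle is a diagram indexed by the strip of integral points (i, j)
   with i <= j <= i + n + 1, zero on both boundary lines, with a natural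
   isomorphism X_{j, i+n+1} = Sigma X_{i, j}.  It is an unrolled way of writing
   a chain X_{01} -> X_{02} -> ... -> X_{0n}, its iterated cones X_{ij}, and
   their connecting morphisms; n = 2 gives triangles, with
   X = X_{01}, Y = X_{02}, C = X_{12}, and n = 3 octahedral diagrams. *)
Record strip (n : nat) := Strip {
  lo : int; hi : int;
  strip_ok : (lo <= hi) && (hi <= lo + n.+1%:Z)
}.

Definition strip_le n (p q : strip n) : bool := (lo p <= lo q) && (hi p <= hi q).

Lemma strip_susp_subproof n (p : strip n) :
  (hi p <= lo p + n.+1%:Z) && (lo p + n.+1%:Z <= hi p + n.+1%:Z).
Proof. by case/andP: (strip_ok p) => h1 h2; rewrite h2 lerD2r. Qed.

Definition strip_susp n (p : strip n) : strip n := Strip (strip_susp_subproof p).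

Lemma strip_le_susp n (p q : strip n) :
  strip_le p q -> strip_le (strip_susp p) (strip_susp q).
Proof. by case/andP=> h1 h2; rewrite /strip_le /= h2 lerD2r. Qed.

Lemma strip_le_refl n (p : strip n) : strip_le p p.
Proof. by rewrite /strip_le !lexx. Qed.

Lemma strip_le_trans n (p q r : strip n) :
  strip_le p q -> strip_le q r -> strip_le p r.
Proof.
by move=> /andP[a b] /andP[c d]; rewrite /strip_le (le_trans a c) (le_trans b d).
Qed.

Record ntri (T : suspCat) (n : nat) := NTri {
  nX :> strip n -> T;
  nA : forall p q, strip_le p q -> Hom (nX p) (nX q);
  nA_id : forall p (h : strip_le p p), nA h = idm (nX p);
  nA_comp : forall p q r (h : strip_le p q) (k : strip_le q r) (l : strip_le p r),
    nA k \c nA h = nA l;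
  nX_lo : forall p, hi p = lo p -> idm (nX p) = 0;
  nX_hi : forall p, hi p = lo p + n.+1%:Z -> idm (nX p) = 0;
  ntau : forall p, Hom (nX (strip_susp p)) (susp (nX p));
  ntau_iso : forall p, is_iso (ntau p);
  ntau_nat : forall p q (h : strip_le p q),
    ntau q \c nA (strip_le_susp h) = fmap susp (nA h) \c ntau p
}.

Arguments nA {T n} _ {p q}.
Arguments ntau {T n} _ p.

Definition is_ntri_map (T : suspCat) n (U V : ntri T n)
    (a : forall p, Hom (U p) (V p)) : Prop :=
  (forall p q (h : strip_le p q), a q \c nA U h = nA V h \c a p) /\
  (forall p, fmap susp (a p) \c ntau U p = ntau V p \c a (strip_susp p)).

(* Monotone maps of integers with phi (i + m + 1) = phi i + n + 1 act on the
   strips.  They are generated by the faces, the degeneracies and the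
   translation i |-> i + 1. *)
Record periodic (m n : nat) := Periodic {
  phi :> int -> int;
  phi_mono : forall i j : int, i <= j -> phi i <= phi j;
  phi_per : forall i : int, phi (i + m.+1%:Z) = phi i + n.+1%:Z
}.

Section Pullback.
Variables (T : suspCat) (m n : nat) (f : periodic m n) (U : ntri T n).

Lemma pb_subproof (p : strip m) :
  (f (lo p) <= f (hi p)) && (f (hi p) <= f (lo p) + n.+1%:Z).
Proof.
case/andP: (strip_ok p) => h1 h2.
by rewrite -phi_per !phi_mono.
Qed.

Definition pb_pt (p : strip m) : strip n := Strip (pb_subproof p).

Lemma pb_le (p q : strip m) : strip_le p q -> strip_le (pb_pt p) (pb_pt q).
Proof. by case/andP=> h1 h2; rewrite /strip_le /= !phi_mono. Qed.

Lemma pb_susp (p : strip m) :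
  strip_le (pb_pt (strip_susp p)) (strip_susp (pb_pt p)).
Proof. by rewrite /strip_le /= phi_per !lexx. Qed.

Lemma pb_susp' (p : strip m) :
  strip_le (strip_susp (pb_pt p)) (pb_pt (strip_susp p)).
Proof. by rewrite /strip_le /= phi_per !lexx. Qed.

Definition ntri_pullback : ntri T m.
Proof.
refine (@NTri T m (fun p => U (pb_pt p)) (fun p q h => nA U (pb_le h)) _ _ _ _
         (fun p => ntau U (pb_pt p) \c nA U (pb_susp p)) _ _).
- by move=> p h; apply: nA_id.
- by move=> p q r h k l; apply: nA_comp.
- by move=> p h; apply: nX_lo; rewrite /= h.
- by move=> p h; apply: nX_hi; rewrite /= h phi_per.
- move=> p; apply: iso_comp; first exact: ntau_iso.
  exists (nA U (pb_susp' p)); split;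
    by rewrite (nA_comp U _ _ (strip_le_refl _)) nA_id.
- move=> p q h.
  rewrite compA -ntau_nat -!compA.
  have h' := strip_le_trans (pb_le (strip_le_susp h)) (pb_susp q).
  by rewrite !(nA_comp U _ _ h').
Defined.

End Pullback.

Section Suspension.
Variables (T : suspCat) (n : nat) (U : ntri T n).

(* With this sign, for n = 2 the triangle (f, i, q) is turned into
   (Sigma f, Sigma i, - Sigma q). *)
Definition ntri_susp : ntri T n.
Proof.
refine (@NTri T n (fun p => susp (U p)) (fun p q h => fmap susp (nA U h)) _ _ _ _
         (fun p => - fmap susp (ntau U p)) _ _).
- by move=> p h; rewrite nA_id fmap1.
- by move=> p q r h k l; rewrite -fmapM (nA_comp U _ _ l).
- by move=> p h; rewrite -fmap1 (nX_lo U h) fmap0.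
- by move=> p h; rewrite -fmap1 (nX_hi U h) fmap0.
- move=> p; have [g [e1 e2]] := fmap_iso susp (ntau_iso U p).
  by exists (- g); rewrite !compNm !compmN !opprK.
- by move=> p q h; rewrite compNm compmN -!fmapM ntau_nat.
Defined.

End Suspension.

Definition fntri (T T' : triCat) (F : exactFun T T') n (U : ntri T n) : ntri T' n.
Proof.
refine (@NTri T' n (fun p => F (U p)) (fun p q h => fmap F (nA U h)) _ _ _ _
         (fun p => fsusp F (U p) \c fmap F (ntau U p)) _ _).
- by move=> p h; rewrite nA_id fmap1.
- by move=> p q r h k l; rewrite -fmapM (nA_comp U _ _ l).
- by move=> p h; rewrite -fmap1 (nX_lo U h) fmap0.
- by move=> p h; rewrite -fmap1 (nX_hi U h) fmap0.
- by move=> p; apply: iso_comp; [exact: fsusp_iso|exact/fmap_iso/ntau_iso].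
- by move=> p q h; rewrite -compA -fmapM ntau_nat fmapM !compA fsusp_nat.
Defined.

Lemma base_pt_subproof n k : (k < n)%N ->
  (0 <= k.+1%:Z) && (k.+1%:Z <= 0 + n.+1%:Z).
Proof. by move=> h; rewrite add0r !lez_nat /= ltnW. Qed.

(* The point (0, k + 1) of the strip, 0 <= k < n. *)
Definition base_pt n k (hk : (k < n)%N) : strip n := Strip (base_pt_subproof hk).

Lemma base_le n k (hk : (k < n)%N) (hk1 : (k.+1 < n)%N) :
  strip_le (base_pt hk) (base_pt hk1).
Proof. by rewrite /strip_le /= lez_nat leqW. Qed.

Notation pt n i j := (@Strip n i j erefl).

Definition ntri_tri (T : suspCat) (U : ntri T 2) : Tri T :=
  MkTri (nA U (erefl : strip_le (pt 2 0 1) (pt 2 0 2)))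
        (nA U (erefl : strip_le (pt 2 0 2) (pt 2 1 2)))
        (ntau U (pt 2 0 1)
          \c nA U (erefl : strip_le (pt 2 1 2) (strip_susp (pt 2 0 1)))).

Definition ntri_oct (T : suspCat) (U : ntri T 3) : Oct T :=
  let qg := ntau U (pt 3 0 2)
    \c nA U (erefl : strip_le (pt 3 2 3) (strip_susp (pt 3 0 2))) in
  let i := nA U (erefl : strip_le (pt 3 0 2) (pt 3 1 2)) in
  MkOct (nA U (erefl : strip_le (pt 3 0 1) (pt 3 0 2))) i
        (ntau U (pt 3 0 1)
          \c nA U (erefl : strip_le (pt 3 1 2) (strip_susp (pt 3 0 1))))
        (nA U (erefl : strip_le (pt 3 0 2) (pt 3 0 3)))
        (nA U (erefl : strip_le (pt 3 0 3) (pt 3 2 3))) qg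
        (nA U (erefl : strip_le (pt 3 0 1) (pt 3 0 3)))
        (nA U (erefl : strip_le (pt 3 0 3) (pt 3 1 3)))
        (ntau U (pt 3 0 1)
          \c nA U (erefl : strip_le (pt 3 1 3) (strip_susp (pt 3 0 1))))
        (nA U (erefl : strip_le (pt 3 1 2) (pt 3 1 3)))
        (nA U (erefl : strip_le (pt 3 1 3) (pt 3 2 3)))
        (fmap susp i \c qg).

(* Higher triangulations after Maltsiniotis.  Stability under the simplicial
   operators and the translation is [ndist_pullback]; together with
   [ndist_susp] it generalizes the rotation of triangles. *)
Record strongTri (T : triCat) := StrongTri {
  ndist : forall n, ntri T n -> Prop;
  ndist_iso : forall n (U V : ntri T n) (a : forall p, Hom (U p) (V p)),
    is_ntri_map a -> (forall p, is_iso (a p)) -> ndist U -> ndist V;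
  ndist_pullback : forall m n (f : periodic m n) (U : ntri T n),
    ndist U -> ndist (ntri_pullback f U);
  ndist_susp : forall n (U : ntri T n), ndist U -> ndist (ntri_susp U);
  ndist_ext : forall n (Y : nat -> T) (y : forall k, Hom (Y k) (Y k.+1)),
    exists (U : ntri T n)
      (a : forall k (hk : (k < n)%N), Hom (Y k) (U (base_pt hk))),
    [/\ ndist U, forall k (hk : (k < n)%N), is_iso (a k hk)
      & forall k (hk : (k < n)%N) (hk1 : (k.+1 < n)%N),
          a k.+1 hk1 \c y k = nA U (base_le hk hk1) \c a k hk];
  ndist_map : forall n (U V : ntri T n)
      (a : forall k (hk : (k < n)%N), Hom (U (base_pt hk)) (V (base_pt hk))),
    ndist U -> ndist V ->
    (forall k (hk : (k < n)%N) (hk1 : (k.+1 < n)%N),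
       a k.+1 hk1 \c nA U (base_le hk hk1) = nA V (base_le hk hk1) \c a k hk) ->
    exists b : forall p, Hom (U p) (V p),
      is_ntri_map b /\ forall k (hk : (k < n)%N), b (base_pt hk) = a k hk;
  ndist_tri : forall D : Tri T,
    dist D <-> exists U : ntri T 2, ndist U /\ tri_iso (ntri_tri U) D
}.

(* Ordinary, special and virtual octahedra of a triangulated category, and
   distinguished octahedra of a strongly triangulated one. *)
Inductive sharp := sharp_b | sharp_d | sharp_v | sharp_s.

Definition enhancement (s : sharp) (T : triCat) : Type :=
  match s with sharp_s => strongTri T | _ => unit end.

Record sharpCat (s : sharp) := SharpCat {
  sharp_base :> triCat;
  sharp_strong : enhancement s sharp_base
}.

Definition sharp_tri (s : sharp) (T : sharpCat s) (D : Tri T) : Prop :=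
  if s is sharp_v then is_virtual D else dist D.

Definition sharp_oct (s : sharp) : forall T : sharpCat s, Oct T -> Prop :=
  match s with
  | sharp_b => fun T O => is_oct_diagram O /\ oct_all (@dist T) O
  | sharp_d => fun T O => [/\ is_oct_diagram O, oct_all (@dist T) O,
                              dist (oct_mv1 O) & dist (oct_mv2 O)]
  | sharp_v => fun T O => is_oct_diagram O /\ oct_all (@is_virtual T) O
  | sharp_s => fun T O =>
      exists U : ntri T 3, ndist (sharp_strong T) U /\ oct_iso (ntri_oct U) O
  end.

Definition sharp_exact (s : sharp) :
    forall T T' : sharpCat s, exactFun T T' -> Prop :=
  match s with
  | sharp_s => fun T T' F => forall n (U : ntri T n),
      ndist (sharp_strong T) U -> ndist (sharp_strong T') (fntri F U)
  | _ => fun _ _ _ => True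
  end.

Record sharpFun (s : sharp) (T T' : sharpCat s) := SharpFun {
  sharp_fun :> exactFun T T';
  sharp_funP : sharp_exact sharp_fun
}.

(* Not necessarily commutative groups, written additively.  The equality of
   the group is an explicit equivalence relation, so that groups given by
   generators and relations are represented by formal expressions. *)
Record sgroup := SGroup {
  gcar :> Type;
  geq : gcar -> gcar -> Prop;
  gzero : gcar;
  gadd : gcar -> gcar -> gcar;
  gopp : gcar -> gcar;
  geq_equiv : Equivalence geq;
  gaddP : Proper (geq ==> geq ==> geq) gadd;
  goppP : Proper (geq ==> geq) gopp;
  gaddA : forall x y z, geq (gadd (gadd x y) z) (gadd x (gadd y z));
  gadd0l : forall x, geq (gadd gzero x) x;
  gaddNl : forall x, geq (gadd (gopp x) x) gzero
}.

Arguments geq {s}.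
Arguments gzero {s}.
Arguments gadd {s}.
Arguments gopp {s}.

Notation "x =g y" := (geq x y) (at level 70, no associativity).
Notation "x +g y" := (gadd x y) (at level 50, left associativity).
Notation "-g x" := (gopp x) (at level 35, right associativity).

#[export] Existing Instance geq_equiv.
#[export] Existing Instance gaddP.
#[export] Existing Instance goppP.
#[export] Hint Extern 0 (geq _ _) => reflexivity : core.

Definition gcomm (G : sgroup) (x y : G) : G := -g x +g -g y +g x +g y.

Section SGroupTheory.
Variable G : sgroup.
Implicit Types x y z : G.

Lemma gaddKl x y : -g x +g (x +g y) =g y.
Proof. by rewrite -gaddA gaddNl gadd0l. Qed.

Lemma gaddIl x y z : x +g y =g x +g z -> y =g z.
Proof. by move=> e; rewrite -(gaddKl x y) e gaddKl. Qed.

Lemma gadd0r x : x +g gzero =g x.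
Proof. by apply: (gaddIl (x := -g x)); rewrite -gaddA gaddNl gadd0l. Qed.

Lemma gaddNr x : x +g -g x =g gzero.
Proof. by apply: (gaddIl (x := -g x)); rewrite gaddKl gadd0r. Qed.

Lemma gaddNKl x y : x +g (-g x +g y) =g y.
Proof. by rewrite -gaddA gaddNr gadd0l. Qed.

Lemma goppE x y : x +g y =g gzero -> y =g -g x.
Proof. by move=> e; apply: (gaddIl (x := x)); rewrite e gaddNr. Qed.

Lemma goppK x : -g -g x =g x.
Proof. by symmetry; apply: goppE; rewrite gaddNl. Qed.

Lemma gopp0 : -g gzero =g (gzero : G).
Proof. by symmetry; apply: goppE; rewrite gadd0l. Qed.

Lemma goppD x y : -g (x +g y) =g -g y +g -g x.
Proof. by symmetry; apply: goppE; rewrite gaddA gaddNKl gaddNr. Qed.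

End SGroupTheory.

Record sabgroup := SAbGroup {
  sab_base :> sgroup;
  gaddC : forall x y : sab_base, x +g y =g y +g x
}.

Definition zquot (A : sabgroup) : Type :=
  {P : A -> Prop | exists x, P = geq x}.

Section ZQuot.
Variable A : sabgroup.

Definition zcls (x : A) : zquot A := exist _ (geq x) (ex_intro _ x erefl).

Definition zrepr (q : zquot A) : A := projT1 (cid (projT2 q)).

Lemma zclsP (x y : A) : zcls x = zcls y <-> x =g y.
Proof.
split=> [/(congr1 (@proj1_sig _ _)) /= e|e]; first by rewrite e.
rewrite /zcls; apply: eq_exist; apply/funext => z; apply/propext.
by split=> h; [rewrite -e|rewrite e].
Qed.

Lemma zreprK (q : zquot A) : zcls (zrepr q) = q.
Proof.
case: q => P e; rewrite /zcls; apply: eq_exist; rewrite /zrepr.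
by case: (cid _) => x /= ->.
Qed.

Lemma zrepr_cls (x : A) : zrepr (zcls x) =g x.
Proof. by apply/zclsP; rewrite zreprK. Qed.

Definition zadd (p q : zquot A) := zcls (zrepr p +g zrepr q).
Definition zopp (p : zquot A) := zcls (-g zrepr p).

Lemma zaddA : associative zadd.
Proof. by move=> p q r; apply/zclsP; rewrite !zrepr_cls gaddA. Qed.
Lemma zaddC : commutative zadd.
Proof. by move=> p q; apply/zclsP; rewrite gaddC. Qed.
Lemma zadd0 : left_id (zcls gzero) zadd.
Proof. by move=> p; rewrite -[RHS]zreprK; apply/zclsP; rewrite zrepr_cls gadd0l. Qed.
Lemma zaddN : left_inverse (zcls gzero) zopp zadd.
Proof. by move=> p; apply/zclsP; rewrite zrepr_cls gaddNl. Qed.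

End ZQuot.

HB.instance Definition _ A := gen_eqMixin (zquot A).
HB.instance Definition _ A := gen_choiceMixin (zquot A).
HB.instance Definition _ A :=
  GRing.isZmodule.Build (zquot A) (@zaddA A) (@zaddC A) (@zadd0 A) (@zaddN A).

Lemma zclsD (A : sabgroup) (x y : A) : zcls (x +g y) = zcls x + zcls y.
Proof. by apply/zclsP; rewrite !zrepr_cls. Qed.

(* A homomorphism from the tensor square of the abelianization of C0 to C1 is
   the same as a map C0 x C0 -> C1 which is additive in each variable:
   expanding <a + a', b + b'> in two ways shows that its values commute. *)
Record sqm := SQM {
  C0 : sgroup;
  C1 : sgroup;
  br : C0 -> C0 -> C1;
  bd : C1 -> C0;
  brP : Proper (geq ==> geq ==> geq) br;
  bdP : Proper (geq ==> geq) bd;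
  brDl : forall a a' b, br (a +g a') b =g br a b +g br a' b;
  brDr : forall a b b', br a (b +g b') =g br a b +g br a b';
  bdD : forall x y, bd (x +g y) =g bd x +g bd y;
  brC : forall a b, br a b +g br b a =g gzero;
  bd_br : forall a b, bd (br a b) =g gcomm b a;
  br_bd : forall x y, br (bd x) (bd y) =g gcomm y x
}.

Arguments br {s}.
Arguments bd {s}.

#[export] Existing Instance brP.
#[export] Existing Instance bdP.

Definition act (C : sqm) (x : C1 C) (a : C0 C) : C1 C := x +g br a (bd x).

Record sqm_hom (C D : sqm) := SQMHom {
  h0 :> C0 C -> C0 D;
  h1 : C1 C -> C1 D;
  h0P : Proper (geq ==> geq) h0;
  h1P : Proper (geq ==> geq) h1;
  h0D : forall a b, h0 (a +g b) =g h0 a +g h0 b;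
  h1D : forall x y, h1 (x +g y) =g h1 x +g h1 y;
  h_bd : forall x, h0 (bd x) =g bd (h1 x);
  h_br : forall a b, h1 (br a b) =g br (h0 a) (h0 b)
}.

#[export] Existing Instance h0P.
#[export] Existing Instance h1P.

Section Additive.
Variables (G H : sgroup) (f : G -> H).
Hypotheses (fP : Proper (geq ==> geq) f) (fD : forall x y, f (x +g y) =g f x +g f y).

Lemma gmap0 : f gzero =g gzero.
Proof. by apply: (gaddIl (x := f gzero)); rewrite -fD !gadd0r. Qed.

Lemma gmapN x : f (-g x) =g -g f x.
Proof. by apply: goppE; rewrite -fD gaddNr gmap0. Qed.

End Additive.

Section HomotopyGroups.
Variable C : sqm.

Lemma bd0 : bd gzero =g (gzero : C0 C).
Proof. exact: gmap0 (@bdP C) (@bdD C). Qed.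

Lemma bdN (x : C1 C) : bd (-g x) =g -g bd x.
Proof. exact: gmapN (@bdP C) (@bdD C) x. Qed.

Lemma br0l (b : C0 C) : br gzero b =g gzero.
Proof.
apply: (gmap0 (f := fun a => br a b)) => [a a' e|a a']; last exact: brDl.
by rewrite e.
Qed.

Lemma br0r (a : C0 C) : br a gzero =g gzero.
Proof.
by apply: (gmap0 (f := br a)) => b b'; apply: brDr.
Qed.

Lemma bd_act (x : C1 C) (a : C0 C) : bd (act x a) =g -g a +g bd x +g a.
Proof. by rewrite /act bdD bd_br /gcomm !gaddA gaddNKl. Qed.

Definition pi0_eq (a b : C0 C) : Prop := exists x, a =g b +g bd x.

Lemma pi0_equiv : Equivalence pi0_eq.
Proof.
split.
- by move=> a; exists gzero; rewrite bd0 gadd0r.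
- by move=> a b [x e]; exists (-g x); rewrite e bdN gaddA gaddNr gadd0r.
- by move=> a b c [x e] [y e']; exists (y +g x); rewrite e e' bdD gaddA.
Qed.

Lemma pi0_addP : Proper (pi0_eq ==> pi0_eq ==> pi0_eq) gadd.
Proof.
move=> a a' [x e] b b' [y e']; exists (act x b' +g y).
by rewrite e e' bdD bd_act !gaddA gaddNKl.
Qed.

Lemma pi0_oppP : Proper (pi0_eq ==> pi0_eq) gopp.
Proof.
move=> a a' [x e]; exists (act (-g x) (-g a')).
by rewrite e bd_act bdN goppD goppK !gaddA gaddKl.
Qed.

Lemma pi0_sub (a b : C0 C) : a =g b -> pi0_eq a b.
Proof. by move=> e; exists gzero; rewrite bd0 gadd0r. Qed.

Definition pi0_sgroup : sgroup :=
  SGroup pi0_equiv pi0_addP pi0_oppP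
    (fun a b c => pi0_sub (gaddA a b c)) (fun a => pi0_sub (gadd0l a))
    (fun a => pi0_sub (gaddNl a)).

Lemma pi0_addC (a b : C0 C) : pi0_eq (a +g b) (b +g a).
Proof.
exists (br b a); rewrite bd_br /gcomm !gaddA.
by rewrite (gaddNKl a) gaddNKl.
Qed.

Definition pi0_ab : sabgroup := @SAbGroup pi0_sgroup pi0_addC.

Definition pi0 : Type := zquot pi0_ab.

Definition pi1_car : Type := {x : C1 C | bd x =g gzero}.

Definition pi1_mk (x : C1 C) (e : bd x =g gzero) : pi1_car := exist _ x e.

Definition pi1_eq (x y : pi1_car) : Prop := sval x =g sval y.

Lemma pi1_equiv : Equivalence pi1_eq.
Proof.
split; rewrite /pi1_eq; [by move=> x|by move=> x y e; symmetry|].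
by move=> x y z e e'; rewrite e.
Qed.

Lemma pi1_zero_subproof : bd (gzero : C1 C) =g gzero. Proof. exact: bd0. Qed.
Lemma pi1_add_subproof (x y : pi1_car) : bd (sval x +g sval y) =g gzero.
Proof. by rewrite bdD (proj2_sig x) (proj2_sig y) gadd0l. Qed.
Lemma pi1_opp_subproof (x : pi1_car) : bd (-g sval x) =g gzero.
Proof. by rewrite bdN (proj2_sig x) gopp0. Qed.

Definition pi1_sgroup : sgroup.
Proof.
refine (@SGroup pi1_car pi1_eq (pi1_mk pi1_zero_subproof)
  (fun x y => pi1_mk (pi1_add_subproof x y))
  (fun x => pi1_mk (pi1_opp_subproof x)) pi1_equiv _ _ _ _ _);
  rewrite /pi1_eq.
- by move=> x x' e y y' e' /=; rewrite e e'.
- by move=> x x' e /=; rewrite e.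
- by move=> x y z /=; rewrite gaddA.
- by move=> x /=; rewrite gadd0l.
- by move=> x /=; rewrite gaddNl.
Defined.

Lemma pi1_addC (x y : pi1_car) : sval x +g sval y =g sval y +g sval x.
Proof.
have e : gcomm (sval x) (sval y) =g gzero.
  by rewrite -br_bd (proj2_sig x) (proj2_sig y) br0l.
apply: (gaddIl (x := -g (sval y +g sval x))).
by rewrite gaddNl -e /gcomm goppD !gaddA.
Qed.

Definition pi1_ab : sabgroup := @SAbGroup pi1_sgroup pi1_addC.

Definition pi1 : Type := zquot pi1_ab.

End HomotopyGroups.

HB.instance Definition _ C := GRing.Zmodule.on (pi0 C).
HB.instance Definition _ C := GRing.Zmodule.on (pi1 C).

Definition pi0_cls (C : sqm) (a : C0 C) : pi0 C := @zcls (pi0_ab C) a.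

Definition pi1_cls (C : sqm) (x : C1 C) (e : bd x =g gzero) : pi1 C :=
  @zcls (pi1_ab C) (pi1_mk e).

Section HomotopyMaps.
Variables (C D : sqm) (h : sqm_hom C D).

Definition pi0_map (p : pi0 C) : pi0 D := pi0_cls (h (zrepr p)).

Lemma pi0_mapE (a : C0 C) : pi0_map (pi0_cls a) = pi0_cls (h a).
Proof.
apply/zclsP; have [x e] := @zrepr_cls (pi0_ab C) a.
by exists (h1 h x); rewrite -h_bd -h0D; apply: h0P.
Qed.

Lemma pi1_map_subproof (x : pi1_car C) : bd (h1 h (sval x)) =g gzero.
Proof. by rewrite -h_bd (proj2_sig x) (gmap0 (@h0P _ _ h) (@h0D _ _ h)). Qed.

Definition pi1_map (p : pi1 C) : pi1 D :=
  pi1_cls (pi1_map_subproof (zrepr p)).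

Lemma pi1_mapE (x : C1 C) (e : bd x =g gzero) (e' : bd (h1 h x) =g gzero) :
  pi1_map (pi1_cls e) = pi1_cls e'.
Proof.
apply/zclsP; have := @zrepr_cls (pi1_ab C) (pi1_mk e).
by rewrite /geq /= /pi1_eq /= => r; rewrite r.
Qed.

Lemma pi0_map_additive : zmod_morphism pi0_map.
Proof.
suff D2 x y : pi0_map (x + y) = pi0_map x + pi0_map y.
  by move=> x y; apply: (addIr (pi0_map y)); rewrite -D2 !subrK.
rewrite -(zreprK x) -(zreprK y) -zclsD !pi0_mapE -zclsD; apply/zclsP.
exact: pi0_sub (h0D h _ _).
Qed.

Lemma pi1_map_additive : zmod_morphism pi1_map.
Proof.
suff D2 x y : pi1_map (x + y) = pi1_map x + pi1_map y.
  by move=> x y; apply: (addIr (pi1_map y)); rewrite -D2 !subrK.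
rewrite -(zreprK x) -(zreprK y) -zclsD.
case: (zrepr x) (zrepr y) => [a ea] [b eb].
rewrite (pi1_mapE ea (pi1_map_subproof (pi1_mk ea))).
rewrite (pi1_mapE eb (pi1_map_subproof (pi1_mk eb))).
rewrite -zclsD (pi1_mapE _ (pi1_map_subproof (pi1_mk (pi1_add_subproof (pi1_mk ea) (pi1_mk eb))))).
by apply/zclsP; rewrite /geq /= /pi1_eq /= h1D.
Qed.

End HomotopyMaps.

HB.instance Definition _ C D (h : sqm_hom C D) :=
  GRing.isZmodMorphism.Build (pi0 C) (pi0 D) (pi0_map h) (pi0_map_additive h).
HB.instance Definition _ C D (h : sqm_hom C D) :=
  GRing.isZmodMorphism.Build (pi1 C) (pi1 D) (pi1_map h) (pi1_map_additive h).

Inductive expr0 (A0 : Type) :=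
  | E0gen of A0 | E0zero | E0add of expr0 A0 & expr0 A0 | E0opp of expr0 A0.

Inductive expr1 (A0 A1 : Type) :=
  | E1gen of A1 | E1zero | E1add of expr1 A0 A1 & expr1 A0 A1
  | E1opp of expr1 A0 A1 | E1br of expr0 A0 & expr0 A0.

Arguments E0zero {A0}.
Arguments E1zero {A0 A1}.
Arguments E1gen {A0 A1}.
Arguments E1br {A0 A1}.

Definition e0comm A0 (x y : expr0 A0) : expr0 A0 :=
  E0add (E0add (E0add (E0opp x) (E0opp y)) x) y.
Definition e1comm A0 A1 (x y : expr1 A0 A1) : expr1 A0 A1 :=
  E1add (E1add (E1add (E1opp x) (E1opp y)) x) y.

Fixpoint ebd A0 A1 (d : A1 -> expr0 A0) (x : expr1 A0 A1) : expr0 A0 :=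
  match x with
  | E1gen g => d g
  | E1zero => E0zero
  | E1add x y => E0add (ebd d x) (ebd d y)
  | E1opp x => E0opp (ebd d x)
  | E1br a b => e0comm b a
  end.

Record presentation := Presentation {
  gen0 : Type;
  gen1 : Type;
  gbd : gen1 -> expr0 gen0;
  rel0 : expr0 gen0 -> expr0 gen0 -> Prop;
  rel1 : expr1 gen0 gen1 -> expr1 gen0 gen1 -> Prop
}.

Section Presented.
Variable P : presentation.
Local Notation E0 := (expr0 (gen0 P)).
Local Notation E1 := (expr1 (gen0 P) (gen1 P)).
Local Notation ebd := (ebd (@gbd P)).

Inductive eq0 : E0 -> E0 -> Prop :=
  | eq0_rel a b : rel0 a b -> eq0 a b
  | eq0_bd x y : eq1 x y -> eq0 (ebd x) (ebd y)
  | eq0_refl a : eq0 a a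
  | eq0_sym a b : eq0 a b -> eq0 b a
  | eq0_trans a b c : eq0 a b -> eq0 b c -> eq0 a c
  | eq0_add a a' b b' : eq0 a a' -> eq0 b b' -> eq0 (E0add a b) (E0add a' b')
  | eq0_opp a a' : eq0 a a' -> eq0 (E0opp a) (E0opp a')
  | eq0_addA a b c : eq0 (E0add (E0add a b) c) (E0add a (E0add b c))
  | eq0_add0 a : eq0 (E0add E0zero a) a
  | eq0_addN a : eq0 (E0add (E0opp a) a) E0zero
with eq1 : E1 -> E1 -> Prop :=
  | eq1_rel x y : rel1 x y -> eq1 x y
  | eq1_refl x : eq1 x x
  | eq1_sym x y : eq1 x y -> eq1 y x
  | eq1_trans x y z : eq1 x y -> eq1 y z -> eq1 x z
  | eq1_add x x' y y' : eq1 x x' -> eq1 y y' -> eq1 (E1add x y) (E1add x' y')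
  | eq1_opp x x' : eq1 x x' -> eq1 (E1opp x) (E1opp x')
  | eq1_br a a' b b' : eq0 a a' -> eq0 b b' -> eq1 (E1br a b) (E1br a' b')
  | eq1_addA x y z : eq1 (E1add (E1add x y) z) (E1add x (E1add y z))
  | eq1_add0 x : eq1 (E1add E1zero x) x
  | eq1_addN x : eq1 (E1add (E1opp x) x) E1zero
  | eq1_brDl a a' b :
      eq1 (E1br (E0add a a') b) (E1add (E1br a b) (E1br a' b))
  | eq1_brDr a b b' :
      eq1 (E1br a (E0add b b')) (E1add (E1br a b) (E1br a b'))
  | eq1_brC a b : eq1 (E1add (E1br a b) (E1br b a)) E1zero
  | eq1_br_bd x y : eq1 (E1br (ebd x) (ebd y)) (e1comm y x).

Definition pres0 : sgroup.
Proof.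
refine (@SGroup E0 eq0 E0zero (@E0add _) (@E0opp _) _ _ _ eq0_addA eq0_add0
          eq0_addN).
- by split; [exact: eq0_refl|exact: eq0_sym|exact: eq0_trans].
- by move=> a a' e b b' e'; apply: eq0_add.
- by move=> a a'; apply: eq0_opp.
Defined.

Definition pres1 : sgroup.
Proof.
refine (@SGroup E1 eq1 E1zero (@E1add _ _) (@E1opp _ _) _ _ _ eq1_addA eq1_add0
          eq1_addN).
- by split; [exact: eq1_refl|exact: eq1_sym|exact: eq1_trans].
- by move=> a a' e b b' e'; apply: eq1_add.
- by move=> a a'; apply: eq1_opp.
Defined.

Definition presented : sqm.
Proof.
refine (@SQM pres0 pres1 (@E1br _ _) ebd _ eq0_bd eq1_brDl eq1_brDr
          (fun _ _ => eq0_refl _) eq1_brC (fun _ _ => eq0_refl _) eq1_br_bd).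
by move=> a a' e b b' e'; apply: eq1_br.
Defined.

Variables (C : sqm) (u0 : gen0 P -> C0 C) (u1 : gen1 P -> C1 C).

Fixpoint eval0 (a : E0) : C0 C :=
  match a with
  | E0gen g => u0 g
  | E0zero => gzero
  | E0add a b => eval0 a +g eval0 b
  | E0opp a => -g eval0 a
  end.

Fixpoint eval1 (x : E1) : C1 C :=
  match x with
  | E1gen g => u1 g
  | E1zero => gzero
  | E1add x y => eval1 x +g eval1 y
  | E1opp x => -g eval1 x
  | E1br a b => br (eval0 a) (eval0 b)
  end.

Hypotheses (u_bd : forall g, eval0 (gbd g) =g bd (u1 g))
  (u_rel0 : forall a b, rel0 a b -> eval0 a =g eval0 b)
  (u_rel1 : forall x y, rel1 x y -> eval1 x =g eval1 y).

Lemma eval_bd x : eval0 (ebd x) =g bd (eval1 x).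
Proof.
elim: x => [g||x IHx y IHy|x IHx|a b] /=; first exact: u_bd.
- by rewrite bd0.
- by rewrite bdD IHx IHy.
- by rewrite bdN IHx.
- by rewrite bd_br.
Qed.

Fixpoint eval0P a b (e : eq0 a b) {struct e} : eval0 a =g eval0 b
with eval1P x y (e : eq1 x y) {struct e} : eval1 x =g eval1 y.
Proof.
- case: e => /=.
  + exact: u_rel0.
  + by move=> x y /eval1P e; rewrite !eval_bd e.
  + by move=> a0.
  + by move=> a0 b0 /eval0P e; symmetry.
  + by move=> a0 b0 c0 /eval0P e /eval0P e'; rewrite e.
  + by move=> a0 a1 b0 b1 /eval0P e /eval0P e'; rewrite e e'.
  + by move=> a0 a1 /eval0P e; rewrite e.
  + by move=> *; exact: gaddA.
  + by move=> *; exact: gadd0l.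
  + by move=> *; exact: gaddNl.
- case: e => /=.
  + exact: u_rel1.
  + by move=> x0.
  + by move=> x0 y0 /eval1P e; symmetry.
  + by move=> x0 y0 z0 /eval1P e /eval1P e'; rewrite e.
  + by move=> x0 x1 y0 y1 /eval1P e /eval1P e'; rewrite e e'.
  + by move=> x0 x1 /eval1P e; rewrite e.
  + by move=> a0 a1 b0 b1 /eval0P e /eval0P e'; rewrite e e'.
  + by move=> *; exact: gaddA.
  + by move=> *; exact: gadd0l.
  + by move=> *; exact: gaddNl.
  + by move=> *; exact: brDl.
  + by move=> *; exact: brDr.
  + by move=> *; exact: brC.
  + by move=> x0 y0; rewrite !eval_bd br_bd.
Qed.

(* The universal property of the presentation. *)
Definition pres_lift : sqm_hom presented C :=
  @SQMHom presented C eval0 eval1 eval0P eval1P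
    (fun a b => reflexivity (R := geq) _) (fun x y => reflexivity (R := geq) _)
    eval_bd (fun a b => reflexivity (R := geq) _).

End Presented.

Section TriIso.
Variable T : suspCat.
Implicit Types D : Tri T.

Lemma zero_iso (X Y : T) (f : Hom X Y) : idm X = 0 -> idm Y = 0 -> is_iso f.
Proof. by move=> eX eY; exists 0; rewrite comp0m compm0 eX eY. Qed.

Lemma summ_in1 (X Y X' Y' : T) (u : Hom X Y) (v : Hom X' Y') :
  summ u v \c in1 X X' = in1 Y Y' \c u.
Proof.
rewrite /summ /pairm compDl -!compA pr1in1 pr2in1.
by rewrite !(compm0, compm1) addr0.
Qed.

Lemma summ_in2 (X Y X' Y' : T) (u : Hom X Y) (v : Hom X' Y') :
  summ u v \c in2 X X' = in2 Y Y' \c v.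
Proof.
rewrite /summ /pairm compDl -!compA pr1in2 pr2in2.
by rewrite !(compm0, compm1) add0r.
Qed.

Lemma summ_comp (X Y Z X' Y' Z' : T) (u : Hom X Y) (v : Hom X' Y')
    (u' : Hom Y Z) (v' : Hom Y' Z') :
  summ u' v' \c summ u v = summ (u' \c u) (v' \c v).
Proof.
apply: copairE; rewrite -!compA ?summ_in1 ?summ_in2 compA.
  by rewrite summ_in1 compA.
by rewrite summ_in2 compA.
Qed.

Lemma summ_id (X Y : T) : summ (idm X) (idm Y) = idm (X \o+ Y).
Proof. by rewrite /summ !comp1m /pairm biprodP. Qed.

Lemma summ_iso (X Y X' Y' : T) (u : Hom X Y) (v : Hom X' Y') :
  is_iso u -> is_iso v -> is_iso (summ u v).
Proof.
move=> [u' [e1 e2]] [v' [e3 e4]]; exists (summ u' v').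
by rewrite !summ_comp e1 e2 e3 e4 !summ_id.
Qed.

Lemma tri_iso_refl D : tri_iso D D.
Proof.
exists (idm _), (idm _), (idm _); split; try exact: iso_id.
by split; rewrite ?fmap1 ?compm1 ?comp1m.
Qed.

Lemma tri_iso_sym D D' : tri_iso D D' -> tri_iso D' D.
Proof.
move=> [a [b [c [[a' [a1 a2]] [b' [b1 b2]] [c' [c1 c2]] [e1 e2 e3]]]]].
exists a', b', c'; split.
- by exists a.
- by exists b.
- by exists c.
- split.
  + rewrite -[LHS]compm1 -a2 !compA; congr (_ \c _).
    by rewrite -compA -e1 compA b1 comp1m.
  + rewrite -[LHS]compm1 -b2 !compA; congr (_ \c _).
    by rewrite -compA -e2 compA c1 comp1m.
  + rewrite -[LHS]compm1 -c2 !compA; congr (_ \c _).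
    by rewrite -compA -e3 compA -fmapM a1 fmap1 comp1m.
Qed.

Lemma tri_iso_trans D1 D2 D3 : tri_iso D1 D2 -> tri_iso D2 D3 -> tri_iso D1 D3.
Proof.
move=> [a [b [c [ia ib ic [e1 e2 e3]]]]] [a' [b' [c' [ia' ib' ic' [f1 f2 f3]]]]].
exists (a' \c a), (b' \c b), (c' \c c); split; try exact: iso_comp.
split.
- by rewrite -compA e1 !compA f1.
- by rewrite -compA e2 !compA f2.
- by rewrite fmapM -compA e3 !compA f3.
Qed.

Lemma tri_sum_iso D1 D1' D2 D2' :
  tri_iso D1 D1' -> tri_iso D2 D2' -> tri_iso (tri_sum D1 D2) (tri_sum D1' D2').
Proof.
move=> [a [b [c [ia ib ic [e1 e2 e3]]]]] [a' [b' [c' [ia' ib' ic' [f1 f2 f3]]]]].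
exists (summ a a'), (summ b b'), (summ c c'); split; try exact: summ_iso.
split => /=.
- by rewrite !summ_comp e1 f1.
- by rewrite !summ_comp e2 f2.
- apply: copairE; rewrite -!compA ?copair_in1 ?copair_in2 ?summ_in1 ?summ_in2.
    rewrite [in RHS]compA copair_in1 compA -fmapM summ_in1 fmapM -!compA.
    by rewrite e3.
  rewrite [in RHS]compA copair_in2 compA -fmapM summ_in2 fmapM -!compA.
  by rewrite f3.
Qed.

Lemma is_triangle_iso D D' : tri_iso D D' -> is_triangle D -> is_triangle D'.
Proof.
move=> /tri_iso_sym [a [b [c [[a' [a1 a2]] [b' [b1 b2]] [c' [c1 c2]] [e1 e2 e3]]]]].
move=> [h1 h2 h3]; split.
- rewrite -(comp1m (ti D' \c tf D')) -c1 -!compA [X in c' \c X]compA e2.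
  by rewrite -compA e1 [X in c' \c X]compA h1 comp0m compm0.
- rewrite -(comp1m (tq D' \c ti D')) -fmap1 -a1 fmapM -!compA.
  rewrite [X in _ \c X]compA e3.
  by rewrite -compA e2 [X in _ \c X]compA h2 comp0m compm0.
- rewrite -(comp1m (_ \c tq D')) -fmap1 -b1 fmapM -!compA.
  rewrite [X in _ \c X]compA -fmapM e1 fmapM -compA e3.
  by rewrite [X in _ \c X]compA h3 comp0m compm0.
Qed.

End TriIso.

Section ExactImages.
Variables (T T' : triCat) (F : exactFun T T').

Lemma ftri_map (D D' : Tri T) (a : Hom (tX D) (tX D')) (b : Hom (tY D) (tY D'))
    (c : Hom (tC D) (tC D')) :
  is_tri_map a b c ->
  @is_tri_map _ (ftri F D) (ftri F D') (fmap F a) (fmap F b) (fmap F c).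
Proof.
move=> [e1 e2 e3]; split=> /=; rewrite -?fmapM ?e1 ?e2 //.
by rewrite compA -fsusp_nat -!compA -!fmapM e3.
Qed.

Lemma ftri_iso (D D' : Tri T) (a : Hom (tX D) (tX D')) (b : Hom (tY D) (tY D'))
    (c : Hom (tC D) (tC D')) :
  is_tri_iso a b c ->
  @is_tri_iso _ (ftri F D) (ftri F D') (fmap F a) (fmap F b) (fmap F c).
Proof.
by move=> [ia ib ic m]; split; try exact: fmap_iso; apply: ftri_map.
Qed.

Lemma ftri_iso_ex (D D' : Tri T) : tri_iso D D' -> tri_iso (ftri F D) (ftri F D').
Proof. by move=> [a [b [c h]]]; do 3 eexists; apply: ftri_iso h. Qed.

Lemma ftri_triangle (D : Tri T) : is_triangle D -> is_triangle (ftri F D).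
Proof.
move=> [e1 e2 e3]; split=> /=.
- by rewrite -fmapM e1 fmap0.
- by rewrite -compA -fmapM e2 fmap0 compm0.
- by rewrite compA -fsusp_nat -compA -fmapM e3 fmap0 compm0.
Qed.

Lemma fsum_in1 (X Y : T) : fsum F X Y \c fmap F (in1 X Y) = in1 (F X) (F Y).
Proof.
rewrite /fsum /pairm compDl -!compA -!fmapM pr1in1 pr2in1 fmap0 fmap1.
by rewrite compm0 addr0 compm1.
Qed.

Lemma fsum_in2 (X Y : T) : fsum F X Y \c fmap F (in2 X Y) = in2 (F X) (F Y).
Proof.
rewrite /fsum /pairm compDl -!compA -!fmapM pr1in2 pr2in2 fmap0 fmap1.
by rewrite compm0 add0r compm1.
Qed.

Lemma fsum_pr1 (X Y : T) : pr1 (F X) (F Y) \c fsum F X Y = fmap F (pr1 X Y).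
Proof. exact: pr1_pair. Qed.

Lemma fsum_pr2 (X Y : T) : pr2 (F X) (F Y) \c fsum F X Y = fmap F (pr2 X Y).
Proof. exact: pr2_pair. Qed.

Lemma fsum_summ (X Y X' Y' : T) (u : Hom X Y) (v : Hom X' Y') :
  fsum F Y Y' \c fmap F (summ u v) = summ (fmap F u) (fmap F v) \c fsum F X X'.
Proof.
apply: pairE; rewrite !compA ?fsum_pr1 ?fsum_pr2 /summ ?pr1_pair ?pr2_pair.
  by rewrite -fmapM pr1_pair -compA fsum_pr1 fmapM.
by rewrite -fmapM pr2_pair -compA fsum_pr2 fmapM.
Qed.

Lemma fsum_pair (X Y Z : T) (u : Hom X Y) (v : Hom X Z) :
  fsum F Y Z \c fmap F (pairm u v) = pairm (fmap F u) (fmap F v).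
Proof.
apply: pairE; rewrite !compA ?fsum_pr1 ?fsum_pr2 -fmapM ?pr1_pair ?pr2_pair //.
Qed.

Lemma fsum_copair (X Y Z : T) (u : Hom X Z) (v : Hom Y Z) :
  copairm (fmap F u) (fmap F v) \c fsum F X Y = fmap F (copairm u v).
Proof.
by rewrite /copairm compDl -!compA fsum_pr1 fsum_pr2 -!fmapM -fmapD.
Qed.

Lemma ftri_sum (D D' : Tri T) :
  tri_iso (ftri F (tri_sum D D')) (tri_sum (ftri F D) (ftri F D')).
Proof.
exists (fsum F _ _), (fsum F _ _), (fsum F _ _); split; try exact: fsum_iso.
split=> /=; try exact: fsum_summ.
rewrite {2}/copairm compDl -!compA fsum_pr1 fsum_pr2 /copairm fmapD !fmapM.
rewrite !compDr !compA -!(compA _ (fsusp F _) (fmap F (fmap susp _))).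
by rewrite !fsusp_nat !compA -!fmapM fsum_in1 fsum_in2.
Qed.

Lemma fzob : idm (F zob) = 0.
Proof. by rewrite -fmap1 zobP fmap0. Qed.

Lemma ftri_contr (X Y Z : T) :
  tri_iso (ftri F (tri_contr X Y Z)) (tri_contr (F X) (F Y) (F Z)).
Proof.
apply: tri_iso_trans (ftri_sum _ _) _; apply: tri_sum_iso; last first.
  exists (idm _), 0, (fsusp F Z); split; try exact: iso_id.
  - by apply: zero_iso; [exact: fzob|exact: zobP].
  - exact: fsusp_iso.
  - split=> /=; rewrite ?comp0m ?fmap0 ?compm0 //.
    by rewrite !fmap1 comp1m comp1m compm1.
apply: tri_iso_trans (ftri_sum _ _) _; apply: tri_sum_iso.
  exists (idm _), (idm _), 0; split; try exact: iso_id.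
  - by apply: zero_iso; [exact: fzob|exact: zobP].
  - by split=> /=; rewrite ?fmap1 ?fmap0 ?compm0 ?comp0m.
exists 0, (idm _), (idm _); split; try exact: iso_id.
- by apply: zero_iso; [exact: fzob|exact: zobP].
- by split=> /=; rewrite ?fmap1 ?fmap0 ?compm0 ?comp0m.
Qed.

Lemma ftri_virtual (D : Tri T) : is_virtual D -> is_virtual (ftri F D).
Proof.
move=> [tD [A [B [C [D' [iD [[f'' h1] [i'' h2] [q'' h3]]]]]]]].
split; first exact: ftri_triangle.
exists (F A), (F B), (F C), (ftri F D'); split.
  apply: tri_iso_trans (ftri_iso_ex iD).
  apply: tri_iso_trans (tri_iso_sym (ftri_sum _ _)).
  apply: tri_sum_iso; first exact: tri_iso_refl.
  by apply: tri_iso_sym; apply: ftri_contr.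
split.
- by exists (fmap F f''); apply: (exact_dist F h1).
- by exists (fmap F i''); apply: (exact_dist F h2).
- by exists (fsusp F _ \c fmap F q''); apply: (exact_dist F h3).
Qed.

Lemma foct_diagram (O : Oct T) : is_oct_diagram O -> is_oct_diagram (foct F O).
Proof.
move=> [[t1 t2 t3 t4] [e1 e2 [e3 e4 e5 e6]]]; split.
  by split; apply: (@ftri_triangle (MkTri _ _ _)).
split=> /=.
- by rewrite e1 fmapM.
- by rewrite e2 fmapM !compA fsusp_nat.
- split; rewrite -?fmapM ?e3 ?e5 //.
    by rewrite -compA -fmapM e4.
  by rewrite -compA -fmapM e6 fmapM !compA fsusp_nat.
Qed.

Lemma foct_mv1 (O : Oct T) :
  tri_iso (ftri F (oct_mv1 O)) (oct_mv1 (foct F O)).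
Proof.
exists (idm _), (fsum F _ _), (idm _).
split; try exact: iso_id; first exact: fsum_iso.
split=> /=.
- by rewrite fsum_pair fmapN compm1.
- by rewrite fsum_copair comp1m.
- by rewrite fmap1 comp1m compm1 fmapM compA.
Qed.

Lemma foct_mv2 (O : Oct T) :
  tri_iso (ftri F (oct_mv2 O)) (oct_mv2 (foct F O)).
Proof.
exists (idm _), (summ (fsusp F _) (idm _) \c fsum F _ _), (fsusp F _).
split; try exact: iso_id; last split=> /=.
- apply: iso_comp; last exact: fsum_iso.
  by apply: summ_iso; [exact: fsusp_iso|exact: iso_id].
- exact: fsusp_iso.
- rewrite -compA fsum_pair compm1 /summ fmapN.
  apply: pairE; rewrite compA ?pr1_pair ?pr2_pair -compA ?pr1_pair ?pr2_pair //.
  by rewrite comp1m.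
- rewrite -fsum_copair !compA; congr (_ \c _).
  by apply: copairE; rewrite -!compA ?summ_in1 ?summ_in2 ?copair_in1 ?copair_in2
    compA ?copair_in1 ?copair_in2 ?fsusp_nat ?compm1.
- by rewrite fmap1 comp1m fsusp_nat fmapM.
Qed.

Lemma foct_iso (O O' : Oct T) : oct_iso O O' -> oct_iso (foct F O) (foct F O').
Proof.
move=> [x [y [z [cf [cg [cgf [h1 h2 h3 h4]]]]]]].
exists (fmap F x), (fmap F y), (fmap F z), (fmap F cf), (fmap F cg), (fmap F cgf).
split; [exact: (ftri_iso h1)|exact: (ftri_iso h2)
       |exact: (ftri_iso h3)|exact: (ftri_iso h4)].
Qed.

Lemma foct_ntri (U : ntri T 3) : oct_iso (ntri_oct (fntri F U)) (foct F (ntri_oct U)).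
Proof.
exists (idm _), (idm _), (idm _), (idm _), (idm _), (idm _).
split; split; try exact: iso_id; split=> /=;
  rewrite ?fmap1 ?comp1m ?compm1 ?fmapM ?compA //.
by rewrite fsusp_nat.
Qed.

End ExactImages.

Lemma oct_iso_trans (T : suspCat) (O O' O'' : Oct T) :
  oct_iso O O' -> oct_iso O' O'' -> oct_iso O O''.
Proof.
move=> [x [y [z [cf [cg [cgf [h1 h2 h3 h4]]]]]]].
move=> [x' [y' [z' [cf' [cg' [cgf' [k1 k2 k3 k4]]]]]]].
exists (x' \c x), (y' \c y), (z' \c z), (cf' \c cf), (cg' \c cg), (cgf' \c cgf).
have tr (D1 D2 D3 : Tri T) a b c a' b' c' : @is_tri_iso _ D1 D2 a b c ->
    @is_tri_iso _ D2 D3 a' b' c' ->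
    @is_tri_iso _ D1 D3 (a' \c a) (b' \c b) (c' \c c).
  move=> [ia ib ic [e1 e2 e3]] [ia' ib' ic' [f1 f2 f3]].
  split; try exact: iso_comp.
  split; first by rewrite -compA e1 !compA f1.
    by rewrite -compA e2 !compA f2.
  by rewrite fmapM -compA e3 !compA f3.
by split; [apply: tr h1 k1|apply: tr h2 k2|apply: tr h3 k3|apply: tr h4 k4].
Qed.

Lemma sharp_tri_image (s : sharp) (T T' : sharpCat s) (F : sharpFun T T')
    (D : Tri T) : sharp_tri D -> sharp_tri (ftri F D).
Proof.
case: s T T' F D => T T' F D /=; try exact: (@exact_dist _ _ F).
exact: ftri_virtual.
Qed.

Lemma sharp_oct_image (s : sharp) (T T' : sharpCat s) (F : sharpFun T T')
    (O : Oct T) : sharp_oct O -> sharp_oct (foct F O).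
Proof.
case: s T T' F O => T T' F O /=.
- move=> [d [h1 h2 h3 h4]]; split; first exact: foct_diagram.
  by split; apply: (@exact_dist _ _ F (MkTri _ _ _)).
- move=> [d [h1 h2 h3 h4] m1 m2]; split.
  + exact: foct_diagram.
  + by split; apply: (@exact_dist _ _ F (MkTri _ _ _)).
  + exact: dist_iso (foct_mv1 F O) (exact_dist F m1).
  + exact: dist_iso (foct_mv2 F O) (exact_dist F m2).
- move=> [d [h1 h2 h3 h4]]; split; first exact: foct_diagram.
  by split; apply: (@ftri_virtual _ _ F (MkTri _ _ _)).
- move=> [U [dU iU]]; exists (fntri F U); split.
    exact: (sharp_funP F).
  exact: oct_iso_trans (foct_ntri F U) (foct_iso F iU).
Qed.

Lemma sharp_tri_iso (s : sharp) (T : sharpCat s) (D D' : Tri T) :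
  tri_iso D D' -> sharp_tri D -> sharp_tri D'.
Proof.
case: s T D D' => T D D' /= e; try exact: dist_iso.
move=> [t [A [B [C [E [i h]]]]]]; split; first exact: is_triangle_iso e t.
exists A, B, C, E; split=> //; apply: tri_iso_trans i.
apply: tri_sum_iso; first exact: tri_iso_sym.
exact: tri_iso_refl.
Qed.

Section Transport.
Variables (T T' : triCat) (F : exactFun T T') (N : T -> T').
Variables (u : forall X, Hom (N X) (F X)) (v : forall X, Hom (F X) (N X)).
Hypotheses (vu : forall X, v X \c u X = idm (N X))
           (uv : forall X, u X \c v X = idm (F X)).

Lemma tr_uiso X : is_iso (u X). Proof. by exists (v X). Qed.
Lemma tr_viso X : is_iso (v X). Proof. by exists (u X). Qed.

Definition tr_map (X Y : T) (f : Hom X Y) : Hom (N X) (N Y) :=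
  v Y \c fmap F f \c u X.

Lemma tr_cancel (A B : T') (X : T) (g : Hom (F X) B) (h : Hom A (F X)) :
  (g \c u X) \c (v X \c h) = g \c h.
Proof. by rewrite -compA (compA (u X)) uv comp1m. Qed.

Definition tr_fun : addFun T T'.
Proof.
refine (@AddFun T T' N tr_map _ _ _).
- by move=> X; rewrite /tr_map fmap1 compm1.
- by move=> X Y Z g f; rewrite /tr_map fmapM -(compA (v Y)) tr_cancel !compA.
- by move=> X Y f g; rewrite /tr_map fmapD compDr compDl.
Defined.

Definition tr_susp (X : T) : Hom (tr_fun (susp X)) (susp (tr_fun X)) :=
  fmap susp (v X) \c fsusp F X \c u (susp X).

Lemma tr_susp_iso X : is_iso (tr_susp X).
Proof.
apply: iso_comp; last exact: tr_uiso.
by apply: iso_comp; [exact/fmap_iso/tr_viso|exact: fsusp_iso].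
Qed.

Lemma tr_susp_nat (X Y : T) (h : Hom X Y) :
  tr_susp Y \c fmap tr_fun (fmap susp h) = fmap susp (fmap tr_fun h) \c tr_susp X.
Proof.
rewrite /tr_susp /= /tr_map -(compA (v _)) tr_cancel.
rewrite !fmapM -!compA (compA (fmap susp (u X))) -fmapM uv fmap1 comp1m.
by rewrite (compA (fsusp F Y)) fsusp_nat -compA.
Qed.

Lemma tr_tri_iso (D : Tri T) :
  @is_tri_iso _ (ftri F D)
    (MkTri (fmap tr_fun (tf D)) (fmap tr_fun (ti D))
           (tr_susp (tX D) \c fmap tr_fun (tq D)))
    (v (tX D)) (v (tY D)) (v (tC D)).
Proof.
split; try exact: tr_viso.
split=> /=; rewrite /tr_map.
- by rewrite -compA uv compm1.
- by rewrite -compA uv compm1.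
- rewrite /tr_susp -(compA (v _)) tr_cancel -!compA uv compm1.
  by rewrite !compA.
Qed.

Lemma tr_dist (D : Tri T) : dist D ->
  dist (MkTri (fmap tr_fun (tf D)) (fmap tr_fun (ti D))
              (tr_susp (tX D) \c fmap tr_fun (tq D))).
Proof.
move=> h; apply: dist_iso (exact_dist F h).
by do 3 eexists; apply: tr_tri_iso.
Qed.

Definition tr_exact : exactFun T T' :=
  @ExactFun T T' tr_fun tr_susp tr_susp_iso tr_susp_nat tr_dist.

Lemma tr_ntri n (U : ntri T n) :
  @is_ntri_map _ n (fntri F U) (fntri tr_exact U) (fun p => v (U p)).
Proof.
split=> [p q h|p] /=; rewrite /tr_map.
  by rewrite -compA uv compm1.
rewrite /tr_susp -(compA (v _)) tr_cancel -!compA uv compm1.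
by rewrite !compA.
Qed.

End Transport.

(* An exact functor F only satisfies F 0 = 0 up to isomorphism, whereas [0] = 0
   is a relation.  [enorm F] is the exact functor isomorphic to F which takes
   the chosen zero object to the chosen zero object and agrees with F on the
   other objects. *)
Section Normalization.
Variables (T T' : triCat) (F : exactFun T T').

Definition norm_data (X : T) : {Y : T' & (Hom Y (F X) * Hom (F X) Y)%type} :=
  match pselect (X = zob) with
  | left _ => existT _ zob (0, 0)
  | right _ => existT _ (F X) (idm (F X), idm (F X))
  end.

Definition norm_ob (X : T) : T' := projT1 (norm_data X).
Definition norm_u (X : T) : Hom (norm_ob X) (F X) := (projT2 (norm_data X)).1.
Definition norm_v (X : T) : Hom (F X) (norm_ob X) := (projT2 (norm_data X)).2.

Lemma norm_vu X : norm_v X \c norm_u X = idm (norm_ob X).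
Proof.
rewrite /norm_v /norm_u /norm_ob /norm_data.
by case: pselect => e /=; rewrite ?comp1m // compm0 zobP.
Qed.

Lemma norm_uv X : norm_u X \c norm_v X = idm (F X).
Proof.
rewrite /norm_v /norm_u /norm_ob /norm_data.
case: pselect => e /=; rewrite ?comp1m // compm0 e.
by rewrite -fmap1 zobP fmap0.
Qed.

Lemma norm_zob : norm_ob zob = zob.
Proof. by rewrite /norm_ob /norm_data; case: pselect. Qed.

Lemma norm_obE (X : T) : X <> zob -> norm_ob X = F X.
Proof. by rewrite /norm_ob /norm_data; case: pselect. Qed.

Definition enorm : exactFun T T' := tr_exact norm_vu norm_uv.

End Normalization.

Lemma fnorm_subproof (s : sharp) (T T' : sharpCat s) (F : sharpFun T T') :
  sharp_exact (enorm F).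
Proof.
case: s T T' F => T T' F //= n U h.
apply: ndist_iso (tr_ntri (norm_vu F) (norm_uv F) U) _ _.
  by move=> p; apply: tr_viso; [exact: norm_vu|exact: norm_uv].
exact: (sharp_funP F).
Qed.

Definition fnorm (s : sharp) (T T' : sharpCat s) (F : sharpFun T T') :
  sharpFun T T' := SharpFun (fnorm_subproof F).

Section DModule.
Variables (s : sharp) (T : sharpCat s).

Inductive Dgen1 :=
  | Diso (X X' : T) (h : Hom X X') of is_iso h
  | Dtri (D : Tri T) of sharp_tri D.

Local Notation "[ 'ob' X ]" := (E0gen X) (format "[ 'ob'  X ]").
Local Notation "x +e y" := (E0add x y) (at level 50, left associativity).
Local Notation "-e x" := (E0opp x) (at level 35, right associativity).
Local Notation "x + y" := (E1add x y).
Local Notation "- x" := (E1opp x).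

Definition Dbd (g : Dgen1) : expr0 T :=
  match g with
  | @Diso X X' _ _ => -e [ob X'] +e [ob X]
  | @Dtri D _ => -e [ob tY D] +e [ob tC D] +e [ob tX D]
  end.

Local Notation E1 := (expr1 T Dgen1).

Definition eiso (X X' : T) (h : Hom X X') (ih : is_iso h) : E1 :=
  E1gen (Diso ih).
Definition etri (D : Tri T) (hD : sharp_tri D) : E1 := E1gen (Dtri hD).
Definition eact (x : E1) (a : expr0 T) : E1 := x + E1br a (ebd Dbd x).

Inductive Drel0 : expr0 T -> expr0 T -> Prop :=
  | Drel_zob : Drel0 [ob zob] E0zero.

(* The proofs carried by generators are universally quantified, hence
   immaterial. *)
Inductive Drel1 : E1 -> E1 -> Prop :=
  | Drel_idm X (h : is_iso (idm X)) : Drel1 (eiso h) E1zero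
  | Drel_id1 X (h : sharp_tri (tri_id1 X)) : Drel1 (etri h) E1zero
  | Drel_id2 X (h : sharp_tri (tri_id2 X)) : Drel1 (etri h) E1zero
  | Drel_comp (X Y Z : T) (k : Hom Y Z) (h : Hom X Y) (ik : is_iso k)
      (ih : is_iso h) (ikh : is_iso (k \c h)) :
      Drel1 (eiso ikh) (eiso ik + eiso ih)
  | Drel_iso (D D' : Tri T) (hD : sharp_tri D) (hD' : sharp_tri D')
      (a : Hom (tX D) (tX D')) (b : Hom (tY D) (tY D')) (c : Hom (tC D) (tC D'))
      (ia : is_iso a) (ib : is_iso b) (ic : is_iso c) :
      is_tri_map a b c ->
      Drel1 (eiso ia + eact (eiso ic) [ob tX D])
            (- etri hD' + eiso ib + etri hD)
  | Drel_oct (O : Oct T) (hf : sharp_tri (oct_f O)) (hg : sharp_tri (oct_g O))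
      (hgf : sharp_tri (oct_gf O)) (ht : sharp_tri (oct_t O)) :
      sharp_oct O ->
      Drel1 (etri hg + etri hf) (etri hgf + eact (etri ht) [ob oX O])
  | Drel_br (X Y : T) (h1 : sharp_tri (tri_split X Y))
      (h2 : sharp_tri (tri_split' X Y)) :
      Drel1 (E1br [ob X] [ob Y]) (- etri h2 + etri h1).

Definition Dpres : presentation := Presentation Dbd Drel0 Drel1.

Definition Dmod : sqm := presented Dpres.

End DModule.

Section DMap.
Variables (s : sharp) (T T' : sharpCat s) (F : sharpFun T T').
Hypothesis F0 : F zob = zob.

Definition Du0 (X : gen0 (Dpres T)) : C0 (Dmod T') := E0gen (F X).

Definition Du1 (g : gen1 (Dpres T)) : C1 (Dmod T') :=
  match g with
  | @Diso _ _ X X' h ih => eiso (fmap_iso F ih)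
  | @Dtri _ _ D hD => etri (sharp_tri_image F hD)
  end.

Lemma etri_eq (D D' : Tri T') (h : sharp_tri D) (h' : sharp_tri D') :
  D = D' -> etri h = etri h'.
Proof. by move=> e; subst D'; rewrite (Prop_irrelevance h h'). Qed.

Lemma eiso_eq (X Y : T') (f f' : Hom X Y) (h : is_iso f) (h' : is_iso f') :
  f = f' -> eiso h = eiso h'.
Proof. by move=> e; subst f'; rewrite (Prop_irrelevance h h'). Qed.

Lemma Dmod_rel (x y : expr1 T' (Dgen1 T')) :
  Drel1 x y -> @geq (C1 (Dmod T')) x y.
Proof. exact: (@eq1_rel (Dpres T')). Qed.

Lemma Du_bd (g : gen1 (Dpres T)) : eval0 Du0 (gbd g) =g bd (Du1 g).
Proof. by case: g. Qed.

Lemma Du_rel0 (a b : expr0 (gen0 (Dpres T))) : rel0 a b -> eval0 Du0 a =g eval0 Du0 b.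
Proof. by case => /=; rewrite /Du0 F0; apply: eq0_rel; constructor. Qed.

Lemma Du_id1 (X Z : T') (i : Hom X Z) (q : Hom Z (susp X)) :
  Z = zob -> forall h : sharp_tri (MkTri (idm X) i q),
  @geq (C1 (Dmod T')) (etri h) gzero.
Proof.
move=> eZ; subst Z => h.
have ei : i = 0 by apply: to_zero; exact: zobP.
have eq : q = 0 by apply: from_zero; exact: zobP.
by subst i q; apply: Dmod_rel; apply: Drel_id1.
Qed.

Lemma Du_id2 (X Z : T') (f : Hom Z X) (q : Hom X (susp Z)) :
  Z = zob -> forall h : sharp_tri (MkTri f (idm X) q),
  @geq (C1 (Dmod T')) (etri h) gzero.
Proof.
move=> eZ; subst Z => h.
have ei : f = 0 by apply: from_zero; exact: zobP.
have eq : q = 0.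
  by apply: to_zero; rewrite -fmap1 zobP fmap0.
by subst f q; apply: Dmod_rel; apply: Drel_id2.
Qed.

Lemma split_map (X Y : T) :
  @is_tri_map _ (ftri F (tri_split X Y)) (tri_split (F X) (F Y))
    (idm _) (fsum F X Y) (idm _).
Proof.
split=> /=.
- by rewrite fsum_in1 compm1.
- by rewrite comp1m fsum_pr2.
- by rewrite fmap0 !compm0 comp0m.
Qed.

Lemma split_map' (X Y : T) :
  @is_tri_map _ (ftri F (tri_split' X Y)) (tri_split' (F X) (F Y))
    (idm _) (fsum F X Y) (idm _).
Proof.
split=> /=.
- by rewrite fsum_in2 compm1.
- by rewrite comp1m fsum_pr1.
- by rewrite fmap0 !compm0 comp0m.
Qed.

Lemma Du_iso (D D' : Tri T') (h : sharp_tri D) (h' : sharp_tri D')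
    (b : Hom (tY D) (tY D')) (ib : is_iso b) (a : Hom (tX D) (tX D'))
    (c : Hom (tC D) (tC D')) (ia : is_iso a) (ic : is_iso c) :
  is_tri_map a b c ->
  @geq (C1 (Dmod T')) (eiso ia) gzero -> @geq (C1 (Dmod T')) (eiso ic) gzero ->
  @geq (C1 (Dmod T')) (etri h') (@gadd (C1 (Dmod T')) (eiso ib) (etri h)).
Proof.
move=> m ea ec.
have := Dmod_rel (Drel_iso h h' ia ib ic m).
rewrite -[E1add _ _]/(@gadd (C1 (Dmod T')) (eiso ia) (act (eiso ic : C1 (Dmod T')) (E0gen (tX D)))).
rewrite -[E1add _ _]/(-g (etri h' : C1 (Dmod T')) +g (eiso ib : C1 (Dmod T'))
   +g (etri h : C1 (Dmod T'))).
rewrite /act ea ec bd0 br0r !gadd0r gaddA => e.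
by apply: (gaddIl (x := -g (etri h' : C1 (Dmod T')))); rewrite -e gaddNl.
Qed.

Lemma Du_rel1 (x y : expr1 (gen0 (Dpres T)) (gen1 (Dpres T))) : rel1 x y -> eval1 Du0 Du1 x =g eval1 Du0 Du1 y.
Proof.
have idz X (h : is_iso (idm X)) : @geq (C1 (Dmod T')) (eiso h) gzero.
  exact: Dmod_rel (Drel_idm h).
case=> {x y}.
- move=> X h /=; rewrite -(eiso_eq (iso_id _) (fmap_iso F h) (esym (fmap1 F X))).
  exact: idz.
- move=> X h /=.
  have h' : sharp_tri (MkTri (idm (F X)) (fmap F (0 : Hom X zob))
              (fsusp F X \c fmap F (0 : Hom zob (susp X)))).
    by have := sharp_tri_image F h; rewrite /ftri /= fmap1.
  rewrite (etri_eq (sharp_tri_image F h) h'); last by rewrite /ftri /= fmap1.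
  exact: Du_id1.
- move=> X h /=.
  have h' : sharp_tri (MkTri (fmap F (0 : Hom zob X)) (idm (F X))
              (fsusp F zob \c fmap F (0 : Hom X (susp zob)))).
    by have := sharp_tri_image F h; rewrite /ftri /= fmap1.
  rewrite (etri_eq (sharp_tri_image F h) h'); last by rewrite /ftri /= fmap1.
  exact: Du_id2.
- move=> X Y Z k h ik ih ikh /=.
  have e := fmapM F k h.
  have ikh' : is_iso (fmap F k \c fmap F h) by rewrite -e; apply: fmap_iso.
  rewrite (eiso_eq (fmap_iso F ikh) ikh' e).
  exact: Dmod_rel (Drel_comp (fmap_iso F ik) (fmap_iso F ih) ikh').
- move=> D D' hD hD' a b c ia ib ic m.
  exact: Dmod_rel (Drel_iso (sharp_tri_image F hD) (sharp_tri_image F hD')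
    (fmap_iso F ia) (fmap_iso F ib) (fmap_iso F ic) (ftri_map F m)).
- move=> O hf hg hgf ht hO.
  exact: Dmod_rel (@Drel_oct _ T' (foct F O) (sharp_tri_image F hf)
    (sharp_tri_image F hg) (sharp_tri_image F hgf) (sharp_tri_image F ht)
    (sharp_oct_image F hO)).
- move=> X Y k1 k2.
  have i0 := fsum_iso F X Y.
  have m1 : tri_iso (ftri F (tri_split X Y)) (tri_split (F X) (F Y)).
    by exists (idm _), (fsum F X Y), (idm _); split; try exact: iso_id;
      [exact: i0|exact: split_map].
  have m2 : tri_iso (ftri F (tri_split' X Y)) (tri_split' (F X) (F Y)).
    by exists (idm _), (fsum F X Y), (idm _); split; try exact: iso_id;
      [exact: i0|exact: split_map'].
  have l1 := sharp_tri_iso m1 (sharp_tri_image F k1).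
  have l2 := sharp_tri_iso m2 (sharp_tri_image F k2).
  have e1 := Du_iso (sharp_tri_image F k1) l1 i0 (split_map X Y)
    (idz _ (iso_id _)) (idz _ (iso_id _)).
  have e2 := Du_iso (sharp_tri_image F k2) l2 i0 (split_map' X Y)
    (idz _ (iso_id _)) (idz _ (iso_id _)).
  have e3 := Dmod_rel (Drel_br l1 l2).
  move: e3; rewrite -[E1add _ _]/(-g (etri l2 : C1 (Dmod T')) +g (etri l1 : C1 (Dmod T'))).
  rewrite e1 e2 goppD gaddA gaddKl => e3.
  exact: e3.
Qed.

Definition Dmap : sqm_hom (Dmod T) (Dmod T') := pres_lift Du_bd Du_rel0 Du_rel1.

End DMap.

Definition K0 (s : sharp) (T : sharpCat s) : zmodType := pi0 (Dmod T).
Definition K1 (s : sharp) (T : sharpCat s) : zmodType := pi1 (Dmod T).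

(* On generators, [X] goes to [F X] and [D] to [F D], except that the chosen
   zero object goes to the chosen zero object, see [enorm]. *)
Definition K0_map (s : sharp) (T T' : sharpCat s) (F : sharpFun T T') :
  {additive K0 T -> K0 T'} := pi0_map (Dmap (F := fnorm F) (norm_zob F)).
Definition K1_map (s : sharp) (T T' : sharpCat s) (F : sharpFun T T') :
  {additive K1 T -> K1 T'} := pi1_map (Dmap (F := fnorm F) (norm_zob F)).

(* Rows X' -> X -> X'', Y' -> Y -> Y'', Z' -> Z -> Z'' and columns
   X' -> Y' -> Z', X -> Y -> Z, X'' -> Y'' -> Z''; a prime is written 1, a
   double prime 2, and no prime 0. *)
Record grid (T : suspCat) := Grid {
  gX1 : T; gX0 : T; gX2 : T;
  gY1 : T; gY0 : T; gY2 : T;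
  gZ1 : T; gZ0 : T; gZ2 : T;
  fX : Hom gX1 gX0; iX : Hom gX0 gX2; qX : Hom gX2 (susp gX1);
  fY : Hom gY1 gY0; iY : Hom gY0 gY2; qY : Hom gY2 (susp gY1);
  fZ : Hom gZ1 gZ0; iZ : Hom gZ0 gZ2; qZ : Hom gZ2 (susp gZ1);
  f1 : Hom gX1 gY1; i1 : Hom gY1 gZ1; q1 : Hom gZ1 (susp gX1);
  f0 : Hom gX0 gY0; i0 : Hom gY0 gZ0; q0 : Hom gZ0 (susp gX0);
  f2 : Hom gX2 gY2; i2 : Hom gY2 gZ2; q2 : Hom gZ2 (susp gX2)
}.

Definition is_3x3 (s : sharp) (T : sharpCat s) (G : grid T) : Prop :=
  [/\ [/\ sharp_tri (MkTri (fX G) (iX G) (qX G)),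
          sharp_tri (MkTri (fY G) (iY G) (qY G))
        & sharp_tri (MkTri (fZ G) (iZ G) (qZ G))],
      [/\ sharp_tri (MkTri (f1 G) (i1 G) (q1 G)),
          sharp_tri (MkTri (f0 G) (i0 G) (q0 G))
        & sharp_tri (MkTri (f2 G) (i2 G) (q2 G))],
      [/\ f0 G \c fX G = fY G \c f1 G,
          f2 G \c iX G = iY G \c f0 G
        & fmap susp (f1 G) \c qX G = qY G \c f2 G],
      [/\ i0 G \c fY G = fZ G \c i1 G,
          i2 G \c iY G = iZ G \c i0 G
        & fmap susp (i1 G) \c qY G = qZ G \c i2 G]
    & [/\ q0 G \c fZ G = fmap susp (fX G) \c q1 G,
          q2 G \c iZ G = fmap susp (iX G) \c q0 G
        & fmap susp (q1 G) \c qZ G + fmap susp (qX G) \c q2 G = 0]].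

(* Every octahedron is listed as its four triangles: those on f, on g, on g f,
   and the one on the cones. *)
Definition coherent_3x3 (s : sharp) (T : sharpCat s) (G : grid T) : Prop :=
  is_3x3 G /\
  exists (W : T) (fb1 : Hom (gX0 G) W) (fbX : Hom (gY1 G) W)
    (delta : Hom (gX1 G) W) (ibX : Hom W (gX2 G)) (ib1 : Hom W (gZ1 G))
    (eps : Hom W (gY0 G)) (kappa : Hom (gZ2 G) (susp W)),
  [/\ sharp_oct (MkOct
        (fX G) (iX G) (qX G)
        fb1 ib1 (fmap susp (fX G) \c q1 G)
        delta (pairm ibX ib1) (copairm (qX G) (q1 G))
        (in1 (gX2 G) (gZ1 G)) (pr2 (gX2 G) (gZ1 G)) 0),
      sharp_oct (MkOct
        (f1 G) (i1 G) (q1 G)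
        fbX ibX (fmap susp (f1 G) \c qX G)
        delta (pairm ibX ib1) (copairm (qX G) (q1 G))
        (in2 (gX2 G) (gZ1 G)) (pr1 (gX2 G) (gZ1 G)) 0),
      sharp_oct (MkOct
        fb1 ib1 (fmap susp (fX G) \c q1 G)
        eps (iZ G \c i0 G) kappa
        (f0 G) (i0 G) (q0 G)
        (fZ G) (iZ G) (qZ G))
    & sharp_oct (MkOct
        fbX ibX (fmap susp (f1 G) \c qX G)
        eps (i2 G \c iY G) kappa
        (fY G) (iY G) (qY G)
        (f2 G) (i2 G) (q2 G))].

Record natTri (s : sharp) (T T' : sharpCat s) (F G H : sharpFun T T') := NatTri {
  nf : forall X : T, Hom (F X) (G X);
  ni : forall X : T, Hom (G X) (H X);
  nq : forall X : T, Hom (H X) (susp (F X));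
  nf_nat : forall (X Y : T) (h : Hom X Y), nf Y \c fmap F h = fmap G h \c nf X;
  ni_nat : forall (X Y : T) (h : Hom X Y), ni Y \c fmap G h = fmap H h \c ni X;
  nq_nat : forall (X Y : T) (h : Hom X Y),
    nq Y \c fmap H h = fmap susp (fmap F h) \c nq X;
  nat_tri : forall X : T, sharp_tri (MkTri (nf X) (ni X) (nq X))
}.

Definition nat_grid (s : sharp) (T T' : sharpCat s) (F G H : sharpFun T T')
    (N : natTri F G H) (D : Tri T) : grid T' :=
  let DF := ftri F D in let DG := ftri G D in let DH := ftri H D in
  Grid (nf N (tX D)) (ni N (tX D)) (nq N (tX D))
       (nf N (tY D)) (ni N (tY D)) (nq N (tY D))
       (nf N (tC D)) (ni N (tC D)) (nq N (tC D))
       (tf DF) (ti DF) (tq DF)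
       (tf DG) (ti DG) (tq DG)
       (tf DH) (ti DH) (tq DH).

(* Main.v *)
From HB Require Import structures.
From mathcomp Require Import all_boot all_order all_algebra.
From mathcomp Require Import boolp.
From mathcomp Require Import zify.
From Stdlib Require Import Setoid Morphisms.

Set Implicit Arguments.
Unset Strict Implicit.
Unset Printing Implicit Defensive.

Import Order.TTheory GRing.Theory Num.Theory.
Require Import Defs.
Local Open Scope ring_scope.

(** The natural triangle N X = (F X -> G X -> H X -> Susp (F X)) gives for each
  object X an element of degree 1 with boundary -[G X] + [H X] + [F X].  The
  theorem says that these elements form a homotopy between G and the sum of H
  and F.  That sum is not a morphism of stable quadratic modules, so a path
  object is built in which it makes sense: its points are quadruples
  (g, h, f, alpha) with bd alpha = -g + h + f, added by
    alpha'' = alpha ^ g' + alpha' + <f, h'>,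
  its elements of degree 1 are triples (x_G, x_H, x_F), and the boundary of such
  a triple has alpha = -x_G + x_H + x_F.  This is a stable quadratic module
  because brackets are central in degree 1 and kill commutators in degree 0.

  A morphism from a presented module to the path object, with components G, H
  and F, forces K(F) + K(H) = K(G) in degrees 0 and 1: the component alpha of a
  point exhibits the identity in pi_0, and if bd x = 0 then the component alpha
  of bd x vanishes, that is -G x + H x + F x = 0 ([homotopy_pi0],
  [homotopy_pi1]).

  By the universal property such a morphism only has to be specified on
  generators, with X going to ([G X], [H X], [F X], [N X]), and the only thing
  to check is the component alpha of the boundary of each generator.  For an
  isomorphism h this is the relation attached to the isomorphism of triangles
  (F h, G h, H h).  For a triangle X -> Y -> Z it is
    [N Y] + [H D] + [F D] + <[F Y], bd [H D]>
      = [G D] + [N Z] ^ [G X] + [N X] + <[F Z], [H X]>,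
  which is obtained by chaining the relations of the four octahedra of a
  coherent 3x3 diagram.  Each of the triangles on F X -> W, G X -> W, F Y -> W
  and W -> G Y occurs in two of the octahedra, so that W disappears; two of the
  octahedra also contain one split triangle each, and the difference of these
  two triangles is a bracket ([coherent_algebra], [coherent_relation]).

  Two geometric facts are used on the way.  The relation of an octahedron is
  indexed by proofs that its four triangles are of the right kind; for
  distinguished 3-triangles this is stability under the four faces
  ([sharp_oct_tri]).  The induced maps on K-theory are defined through functors
  which send the chosen zero object to the chosen zero object; coherence passes
  to them because it is invariant under isomorphism of 3x3 diagrams
  ([coherent_iso]). *)

(** * Stable quadratic modules *)

Section GroupComplements.
Variable G : sgroup.
Implicit Types x y z : G.

Lemma gaddIr x y z : y +g x =g z +g x -> y =g z.
Proof.
by move=> e; rewrite -(gadd0r y) -(gadd0r z) -(gaddNr x) -!gaddA e.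
Qed.

Lemma gadd_comm x y : x +g y =g y +g x +g gcomm x y.
Proof. by rewrite /gcomm !gaddA (gaddNKl x) gaddNKl. Qed.

Lemma gcommP x y k : x +g y =g y +g x +g k -> k =g gcomm x y.
Proof. by move=> e; apply: (gaddIl (x := y +g x)); rewrite -e gadd_comm. Qed.

End GroupComplements.

Section StableQuadratic.
Variable C : sqm.
Implicit Types (a b c : C0 C) (x y : C1 C).

Lemma brNl a b : br (-g a) b =g -g br a b.
Proof. by apply: goppE; rewrite -brDl gaddNr br0l. Qed.

Lemma brNr a b : br a (-g b) =g -g br a b.
Proof. by apply: goppE; rewrite -brDr gaddNr br0r. Qed.

Lemma br_anti a b : br a b =g -g br b a.
Proof. by apply: goppE; rewrite brC. Qed.

(** Both orders of expanding <a + a', b' + b> must agree. *)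
Lemma br_brC a b a' b' : br a b +g br a' b' =g br a' b' +g br a b.
Proof.
apply: (gaddIl (x := br a b')); apply: (gaddIr (x := br a' b)).
have e1 : br (a +g a') (b' +g b) =g br a b' +g (br a b +g br a' b') +g br a' b.
  by rewrite brDl !brDr !gaddA.
have e2 : br (a +g a') (b' +g b) =g br a b' +g (br a' b' +g br a b) +g br a' b.
  by rewrite brDr !brDl !gaddA.
by rewrite -e1 -e2.
Qed.

Lemma br_commr a b c : br a (gcomm b c) =g gzero.
Proof. by rewrite /gcomm !brDr !brNr !gaddA br_brC gaddKl gaddNl. Qed.

Lemma br_comml a b c : br (gcomm b c) a =g gzero.
Proof. by rewrite br_anti br_commr gopp0. Qed.

(** Brackets are central: the commutator of x and <a, b> is the bracket of a
  commutator with bd x, and a bracket kills commutators because its values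
  commute with each other. *)
Lemma br_central a b x : br a b +g x =g x +g br a b.
Proof. by rewrite gadd_comm -br_bd bd_br br_commr gadd0r. Qed.

Lemma br_centralA a b x y : br a b +g (x +g y) =g x +g (br a b +g y).
Proof. by rewrite -gaddA br_central gaddA. Qed.

Lemma bd_comm x y : x +g y =g y +g x +g br (bd y) (bd x).
Proof. by rewrite br_bd -gadd_comm. Qed.

Lemma act_morph x x' a a' : x =g x' -> a =g a' -> act x a =g act x' a'.
Proof. by move=> e e'; rewrite /act e e'. Qed.

Lemma act_add x y a : act (x +g y) a =g act x a +g act y a.
Proof. by rewrite /act bdD brDr !gaddA br_centralA. Qed.

Lemma act0 x : act x gzero =g x.
Proof. by rewrite /act br0l gadd0r. Qed.

Lemma act_zero a : act gzero a =g (gzero : C1 C).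
Proof. by rewrite /act bd0 br0r gadd0r. Qed.

Lemma act_br a b c : act (br a b) c =g br a b.
Proof. by rewrite /act bd_br br_commr gadd0r. Qed.

Lemma act_comm x a b : act x (gcomm a b) =g x.
Proof. by rewrite /act br_comml gadd0r. Qed.

Lemma act_addr x a b : act x (a +g b) =g act (act x a) b.
Proof.
rewrite -[act x a]/(x +g br a (bd x)) act_add act_br /act brDl gaddA.
by rewrite (br_brC b).
Qed.

Lemma act_bd x y : act x (bd y) =g -g y +g x +g y.
Proof.
by rewrite /act br_bd /gcomm !gaddA (gaddNKl x).
Qed.

(** Degree 0 is nilpotent of class 2: a double commutator is the boundary of a
  bracket with a commutator. *)
Lemma gcomm_central a b c : gcomm a b +g c =g c +g gcomm a b.
Proof.
rewrite gadd_comm.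
have -> : gcomm (gcomm a b) c =g gzero by rewrite -bd_br br_commr bd0.
by rewrite gadd0r.
Qed.

Lemma gcomm_centralA a b c d : gcomm a b +g (c +g d) =g c +g (gcomm a b +g d).
Proof. by rewrite -gaddA gcomm_central gaddA. Qed.

End StableQuadratic.

#[export] Instance act_proper (C : sqm) : Proper (geq ==> geq ==> geq) (@act C).
Proof. by move=> x x' e a a' e'; apply: act_morph. Qed.

Section ChainingRelations.
Variable C : sqm.
Implicit Types (a b : C0 C) (f h : C1 C).

(** The last step for the generator of an isomorphism: h and f are exchanged at
  the cost of <bd f, bd h>, which turns the action of the source of f into the
  bracket with its target. *)
Lemma act_exchange f h a b :
  bd f =g -g b +g a -> f +g act h a =g h +g (f +g br b (bd h)).
Proof.
move=> e; rewrite -gaddA (bd_comm h f) e brDl br_brC brNl.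
by rewrite !gaddA gaddNl gadd0r.
Qed.

(** The algebra behind coherence.  Here p, q, r, e stand for the triangles on
  X -> W, Y' -> W, X' -> W and W -> Y, the letters x, y, z and k1, k0, k2 for
  the rows and the columns, and s1, s2 for the two split triangles; the first
  four hypotheses are the relations of the octahedra.  Starting from the left,
  the third relation introduces e + p + x, the first replaces p + x by r and s1,
  the bracket in s1 cancels the one on the left, and the second and fourth
  relations lead to the right hand side. *)
Lemma coherent_algebra (p q r e x y z k1 k0 k2 s1 s2 : C1 C)
    (X1 X0 X2 Y1 Z1 : C0 C) :
    p +g x =g r +g act s1 X1 -> q +g k1 =g r +g act s2 X1 ->
    e +g p =g k0 +g act z X0 -> e +g q =g y +g act k2 Y1 ->
    s1 =g s2 +g br X2 Z1 ->
  k0 +g (act z X0 +g x +g br Z1 X2)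
  =g y +g (k2 +g (k1 +g br Y1 (bd k2))).
Proof.
move=> r1 r2 r3 r4 r5.
rewrite -(gaddA k0) -(gaddA k0) -r3 (gaddA e) r1 r5 act_add act_br.
rewrite -(gaddA r) -r2 -(gaddA e) gaddA brC gadd0r -(gaddA e) r4 /act.
by rewrite !gaddA br_central.
Qed.

End ChainingRelations.

(** * The path object *)

Section PathObject.
Variable C : sqm.

(** A path from pG to pH + pF. *)
Record path_pt := PathPt {
  pG : C0 C; pH : C0 C; pF : C0 C; pA : C1 C;
  pathP : bd pA =g -g pG +g pH +g pF
}.

Definition path_eq (p q : path_pt) : Prop :=
  [/\ pG p =g pG q, pH p =g pH q, pF p =g pF q & pA p =g pA q].

Lemma path_equiv : Equivalence path_eq.
Proof.
split.
- by move=> p; split.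
- by move=> p q [eG eH eF eA]; split; symmetry.
- by move=> p q r [eG eH eF eA] [eG' eH' eF' eA']; split; etransitivity; eauto.
Qed.

Lemma path_zero_subproof : bd gzero =g -g gzero +g gzero +g (gzero : C0 C).
Proof. by rewrite bd0 gopp0 !gadd0l. Qed.

(** The bracket accounts for the exchange of pF p and pH q, and it can be
  placed where it is needed because commutators are central in degree 0. *)
Lemma path_add_subproof (p q : path_pt) :
  bd (act (pA p) (pG q) +g pA q +g br (pF p) (pH q))
  =g -g (pG p +g pG q) +g (pH p +g pH q) +g (pF p +g pF q).
Proof.
rewrite bdD bd_br -gcomm_central bdD bd_act !pathP goppD.
rewrite (gaddA _ (pH p +g pH q)).
have -> : pH p +g pH q +g (pF p +g pF q)
    =g gcomm (pH q) (pF p) +g (pH p +g (pF p +g (pH q +g pF q))).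
  rewrite gcomm_centralA gcomm_centralA -(gaddA _ (pH q)) gcomm_central.
  by rewrite -(gaddA (pF p)) -(gaddA (pF p)) -gadd_comm !gaddA.
rewrite -(gcomm_centralA (pH q) (pF p)); apply: gaddP => //.
by rewrite !gaddA gaddNKl.
Qed.

Definition path_add p q := PathPt (path_add_subproof p q).

Lemma path_opp_subproof (p : path_pt) :
  bd (act (br (pF p) (pH p) +g -g pA p) (-g pG p))
  =g -g -g pG p +g -g pH p +g -g pF p.
Proof.
rewrite bd_act bdD bd_br bdN pathP /gcomm !goppD goppK !gaddA.
by rewrite (gaddNKl (pF p)) (gaddNKl (pH p)) gaddNr gadd0r.
Qed.

Definition path_opp p := PathPt (path_opp_subproof p).

Definition path0 : sgroup.
Proof.
refine (@SGroup path_pt path_eq (PathPt path_zero_subproof) path_add path_opp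
  path_equiv _ _ _ _ _).
- move=> p p' [eG eH eF eA] q q' [eG' eH' eF' eA'].
  by split=> /=; rewrite ?eG ?eG' ?eH ?eH' ?eF ?eF' ?eA ?eA'.
- by move=> p p' [eG eH eF eA]; split=> /=; rewrite ?eG ?eH ?eF ?eA.
- move=> p q r; split=> /=; try exact: gaddA.
  rewrite (act_add (_ +g pA q)) (act_add (act _ _)) act_br -act_addr brDl brDr.
  (* Only brackets, which are central, change places. *)
  move: (act (pA p) _) (act (pA q) _) (pA r) => x y z.
  rewrite (br_brC (pF p) (pH r)) !gaddA.
  by rewrite 2!(br_centralA (pF p) (pH q)).
- move=> p; split=> /=; try exact: gadd0l.
  by rewrite act_zero br0l gadd0l gadd0r.
- move=> p; split=> /=; try exact: gaddNl.
  by rewrite -act_addr gaddNl act0 brNl (gaddA (br _ _)) gaddNl gadd0r gaddNr.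
Defined.

Definition triple_eq (x y : C1 C * C1 C * C1 C) : Prop :=
  [/\ x.1.1 =g y.1.1, x.1.2 =g y.1.2 & x.2 =g y.2].

Definition path1 : sgroup.
Proof.
refine (@SGroup (C1 C * C1 C * C1 C) triple_eq (gzero, gzero, gzero)
  (fun x y => (x.1.1 +g y.1.1, x.1.2 +g y.1.2, x.2 +g y.2))
  (fun x => (-g x.1.1, -g x.1.2, -g x.2)) _ _ _ _ _ _).
- split.
  + by move=> x; split.
  + by move=> x y [e e' e'']; split; symmetry.
  + by move=> x y z [e e' e''] [i i' i'']; split; etransitivity; eauto.
- by move=> x x' [e e' e''] y y' [i i' i'']; split=> /=; apply: gaddP.
- by move=> x x' [e e' e'']; split=> /=; apply: goppP.
- by move=> x y z; split; apply: gaddA.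
- by move=> x; split; apply: gadd0l.
- by move=> x; split; apply: gaddNl.
Defined.

Lemma path_bd_subproof (x : path1) :
  bd (-g x.1.1 +g x.1.2 +g x.2) =g -g bd x.1.1 +g bd x.1.2 +g bd x.2.
Proof. by rewrite !bdD bdN. Qed.

Definition path_bd (x : path1) : path0 := PathPt (path_bd_subproof x).

Definition path_br (p q : path0) : path1 :=
  (br (pG p) (pG q), br (pH p) (pH q), br (pF p) (pF q)).

(** The action of bd yG is conjugation by yG, so that yG cancels, and the
  bracket in the sum of points is the commutator which exchanges xF and yH. *)
Lemma path_bd_add (x y : path1) : path_bd (x +g y) =g path_bd x +g path_bd y.
Proof.
case: x y => [[xG xH] xF] [[yG yH] yF]; split=> /=; try exact: bdD.
rewrite act_bd goppD (gaddA _ (xH +g yH)).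
have -> : xH +g yH +g (xF +g yF)
    =g br (bd xF) (bd yH) +g (xH +g (xF +g (yH +g yF))).
  rewrite 2!br_centralA -(gaddA _ yH) br_central.
  by rewrite -(gaddA xF) -(gaddA xF) -bd_comm !gaddA.
rewrite -!br_centralA -br_central; apply: gaddP => //.
by rewrite !gaddA gaddNKl.
Qed.

(** The brackets which remain when two points of the path object are exchanged.
  As a + g is h + f up to commutators, the left hand side is
  <h + f, a'> + <f', h>, and the rest is bilinearity. *)
Lemma br_path (g h f a g' h' f' a' : C0 C) :
    a =g -g g +g h +g f -> a' =g -g g' +g h' +g f' ->
  br a a' +g (br g a' +g br f' h)
  =g br g' a +g (br f h' +g (-g br g g' +g br h h' +g br f f')).
Proof.
move=> e e'.
have eg z : br g z +g br a z =g br h z +g br f z.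
  by rewrite -brDl e !gaddA gaddNKl brDl.
have ea z : br a z =g -g br g z +g (br h z +g br f z).
  by rewrite -eg gaddKl.
have ea' z : br z a' =g -g br z g' +g (br z h' +g br z f').
  by rewrite e' !brDr brNr gaddA.
rewrite -gaddA (br_brC a) eg !ea' (br_anti g') ea goppD goppD goppK !gaddA.
(* [<f', h>] cancels [<h, f'>], and [<g, g'>] its opposite. *)
rewrite (br_anti f') (br_central h f') !gaddA gaddNl gadd0r.
rewrite (br_centralA g g') gaddNKl.
by rewrite (br_centralA f h') -(brNl f) -!(br_centralA (-g f) g').
Qed.

(** A commutator k of q and p is determined by q + p = p + q + k, so that its
  components need not be expanded. *)
Lemma path_bd_br (p q : path0) : path_bd (path_br p q) =g gcomm q p.
Proof.
apply: gcommP; split=> /=; try by rewrite bd_br -gadd_comm.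
rewrite bd_br act_comm bd_br br_commr gadd0r /act.
have comm := br_path (pathP p) (pathP q).
move: (pA p) (pA q) comm => x y comm.
rewrite !gaddA.
rewrite (br_centralA (pG p)) -(gaddA y) (bd_comm y x) (gaddA (x +g y)) comm.
by rewrite !gaddA (br_centralA (pG q) _ y).
Qed.

(** The form in which the boundary of a generator is computed: adding
  p on both sides avoids the component pA of an opposite, which involves the
  action of -g pG p. *)
Lemma path_bdP (p r : path0) (xG xH xF : C1 C) :
    pG r =g pG p +g bd xG -> pH r =g pH p +g bd xH -> pF r =g pF p +g bd xF ->
    xG +g pA r =g pA p +g (xH +g (xF +g br (pF p) (bd xH))) ->
  -g p +g r =g path_bd (xG, xH, xF).
Proof.
move=> eG eH eF eA; apply: (gaddIl (x := p)); rewrite gaddNKl.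
split=> //=; apply: (gaddIl (x := xG)); rewrite eA act_bd.
by rewrite !gaddA gaddNKl gaddNKl.
Qed.

Definition path_sqm : sqm.
Proof.
refine (@SQM path0 path1 path_br path_bd _ _ _ _ path_bd_add _ path_bd_br _).
- by move=> p p' [eG eH eF _] q q' [iG iH iF _]; split=> /=; apply: brP.
- move=> x y [eG eH eF]; split=> /=; try exact: bdP.
  by rewrite eG eH eF.
- by move=> p p' q; split; apply: brDl.
- by move=> p q q'; split; apply: brDr.
- by move=> p q; split; apply: brC.
- by move=> x y; split; apply: br_bd.
Defined.

End PathObject.

(** * Homotopies out of a presented module *)

Section Homotopy.
Variables (P : presentation) (C : sqm) (F G H : sqm_hom (presented P) C).
Variable alpha : gen0 P -> C1 C.
Hypothesis alpha_bd : forall X,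
  bd (alpha X) =g -g G (E0gen X) +g H (E0gen X) +g F (E0gen X).

Definition path_gen0 (X : gen0 P) : path0 C := PathPt (alpha_bd X).

Definition path_gen1 (g : gen1 P) : path1 C :=
  (h1 G (E1gen g), h1 H (E1gen g), h1 F (E1gen g)).

Definition path_eval0 : expr0 (gen0 P) -> path0 C :=
  @eval0 P (path_sqm C) path_gen0.

Definition path_eval1 : expr1 (gen0 P) (gen1 P) -> path1 C :=
  @eval1 P (path_sqm C) path_gen0 path_gen1.

Lemma path_eval0E (a : expr0 (gen0 P)) :
  [/\ pG (path_eval0 a) =g G a, pH (path_eval0 a) =g H a
    & pF (path_eval0 a) =g F a].
Proof.
have z (K : sqm_hom (presented P) C) : K E0zero =g gzero.
  exact: (gmap0 (@h0P _ _ K) (@h0D _ _ K)).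
have n (K : sqm_hom (presented P) C) x : K (E0opp x) =g -g K x.
  exact: (gmapN (@h0P _ _ K) (@h0D _ _ K) x).
have d (K : sqm_hom (presented P) C) x y : K (E0add x y) =g K x +g K y.
  exact: h0D.
elim: a => [X||a [aG aH aF] b [bG bH bF]|a [aG aH aF]].
- by split.
- by split; rewrite z.
- by split; rewrite d /= -/path_eval0 ?aG ?aH ?aF ?bG ?bH ?bF.
- by split; rewrite n /= -/path_eval0 ?aG ?aH ?aF.
Qed.

Lemma path_eval1E (x : expr1 (gen0 P) (gen1 P)) :
  path_eval1 x =g (h1 G x, h1 H x, h1 F x).
Proof.
have z (K : sqm_hom (presented P) C) : h1 K E1zero =g gzero.
  exact: (gmap0 (@h1P _ _ K) (@h1D _ _ K)).
have n (K : sqm_hom (presented P) C) y : h1 K (E1opp y) =g -g h1 K y.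
  exact: (gmapN (@h1P _ _ K) (@h1D _ _ K) y).
have d (K : sqm_hom (presented P) C) y y' :
    h1 K (E1add y y') =g h1 K y +g h1 K y'.
  exact: h1D.
have b (K : sqm_hom (presented P) C) a a' :
    h1 K (E1br a a') =g br (K a) (K a').
  exact: h_br.
elim: x => [g||x [xG xH xF] y [yG yH yF]|x [xG xH xF]|a a'].
- by split.
- by split=> /=; rewrite z.
- by split; rewrite /= d -/path_eval1 ?xG ?xH ?xF ?yG ?yH ?yF.
- by split; rewrite /= n -/path_eval1 ?xG ?xH ?xF.
- have [aG aH aF] := path_eval0E a; have [aG' aH' aF'] := path_eval0E a'.
  by split; rewrite /= b -/path_eval0 ?aG ?aH ?aF ?aG' ?aH' ?aF'.
Qed.

Hypothesis alpha_rel : forall a b, @rel0 P a b ->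
  pA (path_eval0 a) =g pA (path_eval0 b).
Hypothesis alpha_gen1 : forall g : gen1 P,
  pA (path_eval0 (gbd g))
  =g -g h1 G (E1gen g) +g h1 H (E1gen g) +g h1 F (E1gen g).

Lemma path_eval_bd (g : gen1 P) : path_eval0 (gbd g) =g path_bd (path_gen1 g).
Proof.
have [eG eH eF] := path_eval0E (gbd g).
split; [rewrite eG|rewrite eH|rewrite eF|exact: alpha_gen1].
- exact: (h_bd G (E1gen g)).
- exact: (h_bd H (E1gen g)).
- exact: (h_bd F (E1gen g)).
Qed.

Lemma path_eval_rel0 a b : @rel0 P a b -> path_eval0 a =g path_eval0 b.
Proof.
move=> r; have e : @geq (pres0 P) a b by apply: eq0_rel.
have [aG aH aF] := path_eval0E a; have [bG bH bF] := path_eval0E b.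
by split; [rewrite aG bG|rewrite aH bH|rewrite aF bF|exact: alpha_rel];
  apply: h0P.
Qed.

(** An element of degree 1 of the path object is just a triple, and F, G and H
  respect the relations. *)
Lemma path_eval_rel1 x y : @rel1 P x y -> path_eval1 x =g path_eval1 y.
Proof.
move=> r; have e : @geq (pres1 P) x y by apply: eq1_rel.
by rewrite !path_eval1E; split; apply: h1P.
Qed.

Definition homotopy : sqm_hom (presented P) (path_sqm C) :=
  @pres_lift P (path_sqm C) path_gen0 path_gen1 path_eval_bd path_eval_rel0
    path_eval_rel1.

Lemma homotopy_pi0 : pi0_map F \+ pi0_map H =1 pi0_map G.
Proof.
move=> p; rewrite -(zreprK p) /= !pi0_mapE -zclsD; apply/zclsP.
have [eG eH eF] := path_eval0E (zrepr p).
have [_ _ pi0_trans] := pi0_equiv C; apply: pi0_trans (pi0_addC _ _) _.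
exists (pA (path_eval0 (zrepr p))).
by rewrite pathP eG eH eF !gaddA gaddNKl.
Qed.

(** The homotopy maps bd x = 0 to the zero point, whose component pA is on the
  other hand the value at x of -G + H + F. *)
Lemma homotopy_pi1 : pi1_map F \+ pi1_map H =1 pi1_map G.
Proof.
move=> p; rewrite -(zreprK p).
case: (zrepr p) => x x0.
have e (K : sqm_hom (presented P) C) := pi1_map_subproof K (pi1_mk x0).
rewrite /= !(pi1_mapE _ (e _)) -zclsD; apply/zclsP.
have [_ _ _ hx] := h_bd homotopy x.
have [_ _ _ hx0] := @h0P _ _ homotopy _ _ x0.
have [eG eH eF] := path_eval1E x.
move: hx; rewrite hx0 /= -/path_eval1 eG eH eF /= => hx.
suff: h1 F x +g h1 H x =g h1 G x by [].
apply: (gaddIl (x := -g h1 G x)).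
by rewrite (pi1_addC (pi1_mk (e F)) (pi1_mk (e H))) -gaddA -hx gaddNl.
Qed.

End Homotopy.

(** * The triangles of an octahedron *)

Section Faces.
Variable c : nat.

Lemma face_mono_subproof (i j : int) : i <= j ->
  i + ((i + c%:Z) %/ 3)%Z <= j + ((j + c%:Z) %/ 3)%Z.
Proof. lia. Qed.

Lemma face_per_subproof (i : int) :
  i + 3%:Z + ((i + 3%:Z + c%:Z) %/ 3)%Z = i + ((i + c%:Z) %/ 3)%Z + 4%:Z.
Proof. lia. Qed.

(** For c = 0, 1, 2, 3 the values at 0, 1, 2 are 0 1 2, 0 1 3, 0 2 3 and 1 2 3:
  these are the four faces of a 3-triangle. *)
Definition face : periodic 2 3 :=
  Periodic face_mono_subproof face_per_subproof.

End Faces.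

Section StripSquares.
Variables (T : suspCat) (n : nat) (U : ntri T n).

Lemma nA_iso (p q : strip n) (h : strip_le p q) :
  strip_le q p -> is_iso (nA U h).
Proof.
by move=> k; exists (nA U k); rewrite !(nA_comp U _ _ (strip_le_refl _)) !nA_id.
Qed.

Lemma nA_square (p q q' r : strip n) (h : strip_le p q) (k : strip_le q r)
    (h' : strip_le p q') (k' : strip_le q' r) :
  nA U k \c nA U h = nA U k' \c nA U h'.
Proof. by rewrite !(nA_comp U _ _ (strip_le_trans h k)). Qed.

End StripSquares.

(** The points of the pulled back strip are only known to be equal to the
  expected ones through their coordinates, hence the comparison in both
  directions; the resulting morphisms of the diagram are isomorphisms. *)
Lemma face_tri (T : suspCat) (U : ntri T 3) (f : periodic 2 3)
    (a b d : strip 3) (ab : strip_le a b) (bd : strip_le b d)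
    (da : strip_le d (strip_susp a)) :
  let p := pb_pt f (pt 2 0 1) in let q := pb_pt f (pt 2 0 2) in
  let r := pb_pt f (pt 2 1 2) in
  strip_le p a -> strip_le a p -> strip_le q b -> strip_le b q ->
  strip_le r d -> strip_le d r ->
  tri_iso (ntri_tri (ntri_pullback f U))
    (MkTri (nA U ab) (nA U bd) (ntau U a \c nA U da)).
Proof.
move=> p q r pa ap qb bq rd dr; exists (nA U pa), (nA U qb), (nA U rd).
split; [exact: nA_iso|exact: nA_iso|exact: nA_iso|].
split=> /=; try exact: nA_square.
rewrite !compA -ntau_nat -!compA; congr (_ \c _).
rewrite compA (nA_comp U _ _ (strip_le_trans (pb_susp f _) (strip_le_susp pa))).
exact: nA_square.
Qed.

(** Each triangle of the octahedral diagram is a face. *)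
Lemma ntri_oct_tri (T : triCat) (S : strongTri T) (U : ntri T 3) :
  ndist S U -> oct_all (@dist T) (ntri_oct U).
Proof.
move=> dU.
have di c D : tri_iso (ntri_tri (ntri_pullback (face c) U)) D -> dist D.
  by move=> i; apply/(ndist_tri S); exists (ntri_pullback (face c) U); split;
    [exact: ndist_pullback|].
split.
- by apply: (di 0%N); apply: face_tri.
- by apply: (di 2%N); apply: face_tri.
- by apply: (di 1%N); apply: face_tri.
(* The last morphism of the fourth triangle is defined through the suspension
   of (0, 2) -> (1, 2), and naturality brings it to the form of a face. *)
apply: (di 3%N); rewrite /oct_t /= compA -ntau_nat -compA.
have l : strip_le (pt 3 2 3) (strip_susp (pt 3 1 2)) by [].
by rewrite (nA_comp U _ _ l); apply: face_tri.
Qed.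

Lemma sharp_oct_tri (s : sharp) (T : sharpCat s) (O : Oct T) :
  sharp_oct O -> oct_all (@sharp_tri s T) O.
Proof.
case: s T O => T O /=; try by case.
move=> [U [dU [x [y [z [cf [cg [cgf [if_ ig igf it]]]]]]]]].
have [hf hg hgf ht] := ntri_oct_tri dU.
split; [apply: dist_iso hf|apply: dist_iso hg|apply: dist_iso hgf
       |apply: dist_iso ht]; do 3 eexists; eassumption.
Qed.

(** * Invariance under isomorphism *)

Lemma iso_epi (C : addCat) (X Y Z : C) (f : Hom X Y) (g h : Hom Y Z) :
  is_iso f -> g \c f = h \c f -> g = h.
Proof.
by move=> [f' [_ e]] e'; rewrite -(compm1 g) -(compm1 h) -e !compA e'.
Qed.

Section OctIso.
Variable T : suspCat.
Implicit Types O : Oct T.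

Lemma oct_all_iso (P : Tri T -> Prop) O O' :
  (forall D D', tri_iso D D' -> P D -> P D') ->
  oct_iso O O' -> oct_all P O -> oct_all P O'.
Proof.
move=> Pi [x [y [z [cf [cg [cgf [if_ ig igf it]]]]]]] [hf hg hgf ht].
split; [apply: Pi hf|apply: Pi hg|apply: Pi hgf|apply: Pi ht];
  do 3 eexists; eassumption.
Qed.

Lemma oct_diagram_iso O O' :
  oct_iso O O' -> is_oct_diagram O -> is_oct_diagram O'.
Proof.
move=> i [t [e1 e2 [e3 e4 e5 e6]]].
split; first exact: oct_all_iso (@is_triangle_iso _) i t.
case: i => x [y [z [cf [cg [cgf [[ix iy icf [a1 a2 a3]]
  [_ iz icg [b1 b2 b3]] [_ _ icgf [c1 c2 c3]] [_ _ _ [d1 d2 d3]]]]]]]].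
rewrite /= in a1 a2 a3 b1 b2 b3 c1 c2 c3 d1 d2 d3.
split; last split.
- by apply: (iso_epi ix); rewrite -c1 e1 -!compA -a1 !compA b1.
- by apply: (iso_epi icg); rewrite -d3 e2 -!compA -b3 !compA -!fmapM a2.
- by apply: (iso_epi iy); rewrite -!compA -a2 -b1 !compA -d1 -c2 -!compA e3.
- by apply: (iso_epi icf); rewrite -!compA -d1 compA -c3 -compA e4 a3.
- by apply: (iso_epi iz); rewrite -!compA -c2 compA -d2 -compA e5 b2.
- apply: (iso_epi icgf).
  by rewrite -!compA -d2 -c3 !compA -b3 -fmapM -a1 fmapM -!compA e6.
Qed.

Lemma oct_mv1_iso O O' : oct_iso O O' -> tri_iso (oct_mv1 O) (oct_mv1 O').
Proof.
case=> x [y [z [cf [cg [cgf [[ix iy icf [a1 a2 a3]]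
  [_ iz icg [b1 b2 b3]] [_ _ icgf [c1 c2 c3]] [_ _ _ [d1 d2 d3]]]]]]]].
rewrite /= in a1 a2 a3 b1 b2 b3 c1 c2 c3 d1 d2 d3.
exists y, (summ z cf), cgf; split=> //; first exact: summ_iso.
split=> /=.
- apply: pairE; rewrite !compA /summ ?pr1_pair ?pr2_pair -compA
    ?pr1_pair ?pr2_pair ?compmN ?compNm //.
  by rewrite a2.
- by apply: copairE; rewrite -!compA ?summ_in1 ?summ_in2 ?copair_in1 ?copair_in2
    compA ?copair_in1 ?copair_in2.
- by rewrite compA b3 -!compA d2.
Qed.

Lemma oct_mv2_iso O O' : oct_iso O O' -> tri_iso (oct_mv2 O) (oct_mv2 O').
Proof.
case=> x [y [z [cf [cg [cgf [[ix iy icf [a1 a2 a3]]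
  [_ iz icg [b1 b2 b3]] [_ _ icgf [c1 c2 c3]] [_ _ _ [d1 d2 d3]]]]]]]].
rewrite /= in a1 a2 a3 b1 b2 b3 c1 c2 c3 d1 d2 d3.
exists cgf, (summ (fmap susp x) cg), (fmap susp y).
split; rewrite //; [by apply: summ_iso => //; apply: fmap_iso|exact: fmap_iso|].
split=> /=.
- apply: pairE; rewrite !compA /summ ?pr1_pair ?pr2_pair -compA
    ?pr1_pair ?pr2_pair ?compmN ?compNm //.
  by rewrite d2.
- apply: copairE; rewrite -!compA ?summ_in1 ?summ_in2 ?copair_in1 ?copair_in2
    compA ?copair_in1 ?copair_in2 //.
  by rewrite -!fmapM a1.
- by rewrite -!fmapM compA d1 -!compA a2.
Qed.

End OctIso.

Lemma sharp_oct_iso (s : sharp) (T : sharpCat s) (O O' : Oct T) :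
  oct_iso O O' -> sharp_oct O -> sharp_oct O'.
Proof.
case: s T O O' => T O O' i /=.
- move=> [d a]; split; first exact: oct_diagram_iso d.
  exact: oct_all_iso (@dist_iso T) i a.
- move=> [d a m1 m2]; split; first exact: oct_diagram_iso d.
  + exact: oct_all_iso (@dist_iso T) i a.
  + exact: dist_iso (oct_mv1_iso i) m1.
  + exact: dist_iso (oct_mv2_iso i) m2.
- move=> [d a]; split; first exact: oct_diagram_iso d.
  exact: oct_all_iso (@sharp_tri_iso sharp_v T) i a.
- move=> [U [dU iU]]; exists U; split=> //.
  exact: oct_iso_trans iU i.
Qed.

Section GridIso.
Variable T : suspCat.

Definition row_X (G : grid T) : Tri T := MkTri (fX G) (iX G) (qX G).
Definition row_Y (G : grid T) : Tri T := MkTri (fY G) (iY G) (qY G).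
Definition row_Z (G : grid T) : Tri T := MkTri (fZ G) (iZ G) (qZ G).
Definition col_1 (G : grid T) : Tri T := MkTri (f1 G) (i1 G) (q1 G).
Definition col_0 (G : grid T) : Tri T := MkTri (f0 G) (i0 G) (q0 G).
Definition col_2 (G : grid T) : Tri T := MkTri (f2 G) (i2 G) (q2 G).

Definition grid_iso (G G' : grid T) : Prop :=
  exists (a1 : Hom (gX1 G) (gX1 G')) (a0 : Hom (gX0 G) (gX0 G'))
    (a2 : Hom (gX2 G) (gX2 G')) (b1 : Hom (gY1 G) (gY1 G'))
    (b0 : Hom (gY0 G) (gY0 G')) (b2 : Hom (gY2 G) (gY2 G'))
    (c1 : Hom (gZ1 G) (gZ1 G')) (c0 : Hom (gZ0 G) (gZ0 G'))
    (c2 : Hom (gZ2 G) (gZ2 G')),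
  [/\ @is_tri_iso _ (row_X G) (row_X G') a1 a0 a2,
      @is_tri_iso _ (row_Y G) (row_Y G') b1 b0 b2
    & @is_tri_iso _ (row_Z G) (row_Z G') c1 c0 c2] /\
  [/\ @is_tri_iso _ (col_1 G) (col_1 G') a1 b1 c1,
      @is_tri_iso _ (col_0 G) (col_0 G') a0 b0 c0
    & @is_tri_iso _ (col_2 G) (col_2 G') a2 b2 c2].

End GridIso.

Section CoherentIso.
Variables (s : sharp) (T : sharpCat s) (G G' : grid T).

Lemma is_3x3_iso : grid_iso G G' -> is_3x3 G -> is_3x3 G'.
Proof.
move=> [a1 [a0 [a2 [b1 [b0 [b2 [c1 [c0 [c2 [[rX rY rZ] [k1 k0 k2]]]]]]]]]]].
have tr (D D' : Tri T) a b c : @is_tri_iso _ D D' a b c ->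
    sharp_tri D -> sharp_tri D'.
  by move=> i; apply: sharp_tri_iso; exists a, b, c.
move=> [[tX tY tZ] [t1 t0 t2] [e1 e2 e3] [e4 e5 e6] [e7 e8 e9]].
split.
- by split; [apply: tr rX tX|apply: tr rY tY|apply: tr rZ tZ].
- by split; [apply: tr k1 t1|apply: tr k0 t0|apply: tr k2 t2].
all: case: rX rY rZ k1 k0 k2 => ia1 ia0 ia2 [x1 x2 x3]
  [ib1 ib0 ib2 [y1 y2 y3]] [ic1 ic0 ic2 [z1 z2 z3]]
  [_ _ _ [u1 u2 u3]] [_ _ _ [v1 v2 v3]] [_ _ _ [w1 w2 w3]].
all: rewrite /= in x1 x2 x3 y1 y2 y3 z1 z2 z3 u1 u2 u3 v1 v2 v3 w1 w2 w3.
- split.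
  + by apply: (iso_epi ia1); rewrite -!compA -x1 -u1 !compA -v1 -y1 -!compA e1.
  + by apply: (iso_epi ia0); rewrite -!compA -x2 -v1 !compA -w1 -y2 -!compA e2.
  + by apply: (iso_epi ia2); rewrite -!compA -x3 -w1 !compA -fmapM -u1 fmapM
      -y3 -!compA e3.
- split.
  + by apply: (iso_epi ib1); rewrite -!compA -y1 -u2 !compA -v2 -z1 -!compA e4.
  + by apply: (iso_epi ib0); rewrite -!compA -y2 -v2 !compA -w2 -z2 -!compA e5.
  + by apply: (iso_epi ib2); rewrite -!compA -y3 -w2 !compA -fmapM -u2 fmapM
      -z3 -!compA e6.
- split.
  + by apply: (iso_epi ic1); rewrite -!compA -z1 -u3 !compA -v3 -fmapM -x1 fmapM
      -!compA e7.
  + by apply: (iso_epi ic0); rewrite -!compA -z2 -v3 !compA -w3 -fmapM -x2 fmapM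
      -!compA e8.
  + apply: (iso_epi ic2); rewrite comp0m compDl -!compA -z3 -w3 !compA -!fmapM.
    by rewrite -u3 -x3 !fmapM -!compA -compDr e9 compm0.
Qed.

(** The octahedra are transported with the same object W, the morphisms into
  and out of W being composed with the given isomorphisms. *)
Lemma coherent_iso : grid_iso G G' -> coherent_3x3 G -> coherent_3x3 G'.
Proof.
move=> gi [g [W [fb1 [fbX [delta [jX [j1 [eps [kappa [o1 o2 o3 o4]]]]]]]]]].
split; first exact: is_3x3_iso gi g.
case: gi => a1 [a0 [a2 [b1 [b0 [b2 [c1 [c0 [c2 [[rX rY rZ] [k1 k0 k2]]]]]]]]]].
have [[ia1 ia0 ia2 [x1 x2 x3]] [ib1 ib0 ib2 [y1 y2 y3]]
  [ic1 ic0 ic2 [z1 z2 z3]]] := And3 rX rY rZ.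
have [[_ _ _ [u1 u2 u3]] [_ _ _ [v1 v2 v3]] [_ _ _ [w1 w2 w3]]] :=
  And3 k1 k0 k2.
rewrite /= in x1 x2 x3 y1 y2 y3 z1 z2 z3 u1 u2 u3 v1 v2 v3 w1 w2 w3.
case: (ia1) (ia0) (ib1) (ic2) => [a1' [a1K _]] [a0' [a0K _]] [b1' [b1K _]]
  [c2' [c2K _]].
have iW := iso_id W.
have iA : @is_tri_iso _ (MkTri fb1 j1 (fmap susp (fX G) \c q1 G))
    (MkTri (fb1 \c a0') (c1 \c j1) (fmap susp (fX G') \c q1 G')) a0 (idm W) c1.
  split=> //; split=> /=; rewrite ?compm1 ?comp1m //.
    by rewrite -compA a0K compm1.
  by rewrite compA -fmapM x1 fmapM -!compA u3.
have iB : @is_tri_iso _ (MkTri fbX jX (fmap susp (f1 G) \c qX G))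
    (MkTri (fbX \c b1') (a2 \c jX) (fmap susp (f1 G') \c qX G')) b1 (idm W) a2.
  split=> //; split=> /=; rewrite ?compm1 ?comp1m //.
    by rewrite -compA b1K compm1.
  by rewrite compA -fmapM u1 fmapM -!compA x3.
have iD : @is_tri_iso _ (MkTri delta (pairm jX j1) (copairm (qX G) (q1 G)))
    (MkTri (delta \c a1') (pairm (a2 \c jX) (c1 \c j1))
       (copairm (qX G') (q1 G'))) a1 (idm W) (summ a2 c1).
  split=> //; first exact: summ_iso.
  split=> /=; rewrite ?compm1 ?comp1m.
  - by rewrite -compA a1K compm1.
  - by apply: pairE; rewrite compA /summ ?pr1_pair ?pr2_pair -compA
      ?pr1_pair ?pr2_pair.
  - by apply: copairE; rewrite -!compA ?summ_in1 ?summ_in2 ?copair_in1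
      ?copair_in2 compA ?copair_in1 ?copair_in2 ?x3 ?u3.
have iE : @is_tri_iso _ (MkTri eps (iZ G \c i0 G) kappa)
    (MkTri (b0 \c eps) (iZ G' \c i0 G') (kappa \c c2')) (idm W) b0 c2.
  split=> //; split=> /=; rewrite ?compm1 ?comp1m ?fmap1 ?comp1m //.
    by rewrite compA z2 -!compA v2.
  by rewrite -compA c2K compm1.
have iE' : @is_tri_iso _ (MkTri eps (i2 G \c iY G) kappa)
    (MkTri (b0 \c eps) (i2 G' \c iY G') (kappa \c c2')) (idm W) b0 c2.
  split=> //; split=> /=; rewrite ?compm1 ?comp1m ?fmap1 ?comp1m //.
    by rewrite compA w2 -!compA y2.
  by rewrite -compA c2K compm1.
exists W, (fb1 \c a0'), (fbX \c b1'), (delta \c a1'), (a2 \c jX), (c1 \c j1),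
  (b0 \c eps), (kappa \c c2').
split.
- apply: sharp_oct_iso o1; exists a1, a0, (idm W), a2, c1, (summ a2 c1).
  split=> //; split=> //=; first exact: summ_iso.
  by split=> /=; rewrite ?summ_in1 ?compm0 ?comp0m // /summ pr2_pair.
- apply: sharp_oct_iso o2; exists a1, b1, (idm W), c1, a2, (summ a2 c1).
  split=> //; split=> //=; first exact: summ_iso.
  by split=> /=; rewrite ?summ_in2 ?compm0 ?comp0m // /summ pr1_pair.
- by apply: sharp_oct_iso o3; exists a0, (idm W), b0, c1, c2, c0.
- by apply: sharp_oct_iso o4; exists b1, (idm W), b0, a2, c2, b2.
Qed.

End CoherentIso.

(** * Relations between generators *)

Section Relations.
Variables (s : sharp) (T : sharpCat s).
Local Notation D1 := (C1 (Dmod T)).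

Lemma tri_zero (D : Tri T) (h : sharp_tri D) :
  tX D = zob -> tY D = zob -> tC D = zob -> (etri h : D1) =g gzero.
Proof.
case: D h => X Y C f i q h /= eX eY eC; subst X Y C.
have e : f = idm zob by rewrite zobP (from_zero f) ?zobP.
by subst f; apply: Du_id1.
Qed.

Lemma iso_relation (D D' : Tri T) (hD : sharp_tri D) (hD' : sharp_tri D')
    (a : Hom (tX D) (tX D')) (b : Hom (tY D) (tY D')) (c : Hom (tC D) (tC D'))
    (ia : is_iso a) (ib : is_iso b) (ic : is_iso c) :
  is_tri_map a b c ->
  (eiso ib : D1) +g etri hD
  =g (etri hD' : D1) +g ((eiso ia : D1) +g act (eiso ic : D1) (E0gen (tX D))).
Proof.
move=> m; have e : (eiso ia : D1) +g act (eiso ic : D1) (E0gen (tX D))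
    =g -g (etri hD' : D1) +g eiso ib +g etri hD.
  exact: (Dmod_rel (Drel_iso hD hD' ia ib ic m)).
by rewrite e gaddA gaddNKl.
Qed.

Lemma oct_relation (O : Oct T) (hO : sharp_oct O) (hf : sharp_tri (oct_f O))
    (hg : sharp_tri (oct_g O)) (hgf : sharp_tri (oct_gf O))
    (ht : sharp_tri (oct_t O)) :
  (etri hg : D1) +g etri hf
  =g (etri hgf : D1) +g act (etri ht : D1) (E0gen (oX O)).
Proof. exact: (Dmod_rel (Drel_oct hf hg hgf ht hO)). Qed.

Lemma split_relation (X Y : T) (h1 : sharp_tri (tri_split X Y))
    (h2 : sharp_tri (tri_split' X Y)) :
  (etri h1 : D1) =g (etri h2 : D1) +g br (E0gen X : C0 (Dmod T)) (E0gen Y).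
Proof.
have -> : br (E0gen X : C0 (Dmod T)) (E0gen Y) =g -g (etri h2 : D1) +g etri h1.
  exact: (Dmod_rel (Drel_br h1 h2)).
by rewrite gaddNKl.
Qed.

(** The contribution of a triangle to the homotopy: the middle object of the
  diagram is decomposed into the four corners along the middle column and then
  the rows X and Z on the left, and along the middle row and then the outer
  columns on the right.  The brackets account for the order of the corners. *)
Lemma coherent_relation (G : grid T) (hX : sharp_tri (row_X G))
    (hY : sharp_tri (row_Y G)) (hZ : sharp_tri (row_Z G))
    (k1 : sharp_tri (col_1 G)) (k0 : sharp_tri (col_0 G))
    (k2 : sharp_tri (col_2 G)) :
  coherent_3x3 G ->
  (etri k0 : D1) +g (act (etri hZ : D1) (E0gen (gX0 G)) +g etri hX
     +g br (E0gen (gZ1 G) : C0 (Dmod T)) (E0gen (gX2 G)))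
  =g (etri hY : D1) +g ((etri k2 : D1) +g ((etri k1 : D1)
       +g br (E0gen (gY1 G) : C0 (Dmod T)) (bd (etri k2 : D1)))).
Proof.
move=> [[_ _ _ [_ e _] _]].
move=> [W [fb1 [fbX [delta [jX [j1 [eps [kappa [o1 o2 o3 o4]]]]]]]]].
(* Both octahedra over W -> Y now contain literally the same triangle on it. *)
rewrite e in o4.
have [_ hA hD hS] := sharp_oct_tri o1.
have [_ hB _ hS'] := sharp_oct_tri o2.
have [_ hE _ _] := sharp_oct_tri o3.
have r1 := oct_relation o1 hX hA hD hS.
have r2 := oct_relation o2 k1 hB hD hS'.
have r3 := oct_relation o3 hA hE k0 hZ.
have r4 := oct_relation o4 hB hE hY k2.
have r5 := @split_relation _ _ hS hS'.
exact: coherent_algebra r1 r2 r3 r4 r5.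
Qed.

End Relations.

(** * Normalized functors *)

Section Normalized.
Variables (s : sharp) (T T' : sharpCat s) (F G H : sharpFun T T').
Variable N : natTri F G H.

Let uF := norm_u F. Let uG := norm_u G. Let uH := norm_u H.
Let vF := norm_v F. Let vG := norm_v G. Let vH := norm_v H.

Definition norm_f X : Hom (fnorm F X) (fnorm G X) := vG X \c nf N X \c uF X.
Definition norm_i X : Hom (fnorm G X) (fnorm H X) := vH X \c ni N X \c uG X.
Definition norm_q X : Hom (fnorm H X) (susp (fnorm F X)) :=
  fmap susp (vF X) \c nq N X \c uH X.

Lemma norm_tri_iso X :
  @is_tri_iso _ (MkTri (nf N X) (ni N X) (nq N X))
    (MkTri (norm_f X) (norm_i X) (norm_q X)) (vF X) (vG X) (vH X).
Proof.
split; try (exact: tr_viso (norm_vu _) (norm_uv _) _).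
by split; rewrite /= /norm_f /norm_i /norm_q -!compA norm_uv compm1.
Qed.

Lemma norm_f_nat X Y (h : Hom X Y) :
  norm_f Y \c fmap (fnorm F) h = fmap (fnorm G) h \c norm_f X.
Proof.
rewrite /= /tr_map /norm_f -!compA (compA (uF Y)) norm_uv comp1m.
by rewrite (compA (uG X)) norm_uv comp1m (compA (nf N Y)) nf_nat !compA.
Qed.

Lemma norm_i_nat X Y (h : Hom X Y) :
  norm_i Y \c fmap (fnorm G) h = fmap (fnorm H) h \c norm_i X.
Proof.
rewrite /= /tr_map /norm_i -!compA (compA (uG Y)) norm_uv comp1m.
by rewrite (compA (uH X)) norm_uv comp1m (compA (ni N Y)) ni_nat !compA.
Qed.

Lemma norm_q_nat X Y (h : Hom X Y) :
  norm_q Y \c fmap (fnorm H) h = fmap susp (fmap (fnorm F) h) \c norm_q X.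
Proof.
rewrite /= /tr_map /norm_q -!compA (compA (uH Y)) norm_uv comp1m.
rewrite (compA (nq N Y)) nq_nat !fmapM -!compA.
by rewrite (compA (fmap susp (uF X))) -fmapM norm_uv fmap1 comp1m.
Qed.

Lemma norm_tri X : sharp_tri (MkTri (norm_f X) (norm_i X) (norm_q X)).
Proof.
apply: sharp_tri_iso (nat_tri N X); do 3 eexists; exact: norm_tri_iso.
Qed.

Definition natTri_norm : natTri (fnorm F) (fnorm G) (fnorm H) :=
  NatTri norm_f_nat norm_i_nat norm_q_nat norm_tri.

Lemma nat_grid_norm D : grid_iso (nat_grid N D) (nat_grid natTri_norm D).
Proof.
exists (vF (tX D)), (vG (tX D)), (vH (tX D)), (vF (tY D)), (vG (tY D)),
  (vH (tY D)), (vF (tC D)), (vG (tC D)), (vH (tC D)).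
split; split; try exact: norm_tri_iso; exact: tr_tri_iso.
Qed.

End Normalized.

(** * Additivity *)

Section Additivity.
Variables (s : sharp) (T T' : sharpCat s) (F G H : sharpFun T T').
Hypotheses (F0 : F zob = zob) (G0 : G zob = zob) (H0 : H zob = zob).
Variable N : natTri F G H.
Hypothesis cohN : forall D : Tri T, sharp_tri D -> coherent_3x3 (nat_grid N D).

Definition nat_path (X : T) : C1 (Dmod T') := etri (nat_tri N X).

Lemma nat_path_bd (X : gen0 (Dpres T)) :
  bd (nat_path X)
  =g -g Dmap G0 (E0gen X) +g Dmap H0 (E0gen X) +g Dmap F0 (E0gen X).
Proof. by []. Qed.

(** The only relation in degree 0 is [0] = 0, and the natural triangle at the
  zero object is trivial since F, G and H preserve that object strictly. *)
Lemma nat_path_rel a b : @rel0 (Dpres T) a b ->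
  pA (path_eval0 nat_path_bd a) =g pA (path_eval0 nat_path_bd b).
Proof. by case=> /=; apply: tri_zero. Qed.

Local Notation P X := (path_gen0 nat_path_bd (X : gen0 (Dpres T))).

Lemma nat_path_iso (X Y : T) (h : Hom X Y) (ih : is_iso h) :
  -g P Y +g P X =g path_bd (path_gen1 (Dmap F0) (Dmap G0) (Dmap H0)
                             (Diso ih : gen1 (Dpres T))).
Proof.
have k (y x : C0 (Dmod T')) : x =g y +g (-g y +g x) by rewrite gaddNKl.
apply: path_bdP; try exact: k.
apply: (transitivity (iso_relation (nat_tri N X) (nat_tri N Y) (fmap_iso F ih)
  (fmap_iso G ih) (fmap_iso H ih) _)).
  by split; [rewrite nf_nat|rewrite ni_nat|rewrite nq_nat].
by apply: gaddP => //; apply: act_exchange.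
Qed.

Lemma nat_path_tri (D : Tri T) (hD : sharp_tri D) :
  -g P (tY D) +g P (tC D) +g P (tX D)
  =g path_bd (path_gen1 (Dmap F0) (Dmap G0) (Dmap H0)
                             (Dtri hD : gen1 (Dpres T))).
Proof.
have k (y c x : C0 (Dmod T')) : c +g x =g y +g (-g y +g c +g x).
  by rewrite !gaddA gaddNKl.
rewrite gaddA; apply: path_bdP; try exact: k.
exact: (coherent_relation (G := nat_grid N D) (nat_tri N _) (nat_tri N _)
  (nat_tri N _) (sharp_tri_image F hD) (sharp_tri_image G hD)
  (sharp_tri_image H hD) (cohN hD)).
Qed.

Lemma nat_path_gen1 (g : gen1 (Dpres T)) :
  pA (path_eval0 nat_path_bd (gbd g))
  =g -g h1 (Dmap G0) (E1gen g) +g h1 (Dmap H0) (E1gen g)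
     +g h1 (Dmap F0) (E1gen g).
Proof.
by case: g => [X Y h ih|D hD];
  [case: (nat_path_iso ih)|case: (nat_path_tri hD)].
Qed.

Lemma Dmap_additivity :
  (pi0_map (Dmap F0) \+ pi0_map (Dmap H0) =1 pi0_map (Dmap G0)) /\
  (pi1_map (Dmap F0) \+ pi1_map (Dmap H0) =1 pi1_map (Dmap G0)).
Proof.
split; [exact: (homotopy_pi0 nat_path_bd)|].
exact: (homotopy_pi1 nat_path_rel nat_path_gen1).
Qed.

End Additivity.

Theorem theorem2p3p1 (s : sharp) (T T' : sharpCat s) (F G H : sharpFun T T')
    (N : natTri F G H) :
  (forall D : Tri T, sharp_tri D -> coherent_3x3 (nat_grid N D)) ->
  (K0_map F \+ K0_map H =1 K0_map G) /\ (K1_map F \+ K1_map H =1 K1_map G).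
Proof.
move=> cohN; apply: (@Dmap_additivity s T T' (fnorm F) (fnorm G) (fnorm H) _ _ _
  (natTri_norm N)) => D hD.
exact: coherent_iso (nat_grid_norm N D) (cohN D hD).
Qed.
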